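(* Consider the simple random walk on the Schreier graph $\Upsilon$ of the action of Thompson's group $F$ on the orbit of $\tfrac12$. Let $p_n$ be the probability that the walk started at $\tfrac12$ is at $\tfrac12$ after $n$ steps. Then there exist constants $A,B$ such that $$p_{2n}=An^{-3/2}+O(n^{-2}),\qquad p_{2n+1}=Bn^{-3/2}+O(n^{-2})\qquad\text{as } n\to\infty .$$
   Context: Thompson's group $F$ is the group of homeomorphisms of $[0,1]$ generated by $a,b$, where $a(x)=x/2$ for $x\in[0,\frac12)$, $a(x)=x-\frac14$ for $x\in[\frac12,\frac34)$, $a(x)=2x-1$ for $x\in[\frac34,1]$; and $b(x)=x$ for $x\in[0,\frac12)$, $b(x)=\frac12a(2x-1)+\frac12$ for $x\in[\frac12,1]$. The simple random walk on $\Upsilon$ is the Markov chain on the orbit $F\cdot\frac12$ which from $y$ moves to each of $ay,\ a^{-1}y,\ by,\ b^{-1}y$ with probability $\frac14$ (probabilities adding up if some of these points coincide, including staying at $y$ when a generator fixes $y$). *)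

(* Defs.v *)
From HB Require Import structures.
From mathcomp Require Import all_boot all_order all_algebra.
From mathcomp Require Import all_classical all_reals all_analysis.
From mathcomp Require Import ring lra.

Set Implicit Arguments.
Unset Strict Implicit.
Unset Printing Implicit Defensive.

Import Order.TTheory GRing.Theory Num.Theory.
Import numFieldNormedType.Exports.

Local Open Scope classical_set_scope.
Local Open Scope ring_scope.

Notation unit_itv R := {x : R | 0 <= x <= 1}.

Section Generators.
Variable R : realType.
Implicit Types x y : R.

(* The piecewise affine formulas, and those of the inverses, are first written
   on all of R and then restricted to [0, 1]. *)
Definition a_fun x : R :=
  if x < 2^-1 then x / 2 else if x < 3 / 4 then x - 4^-1 else 2 * x - 1.

Definition a_inv_fun y : R :=
  if y < 4^-1 then 2 * y else if y < 2^-1 then y + 4^-1 else (y + 1) / 2.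

Definition b_fun x : R :=
  if x < 2^-1 then x else 2^-1 * a_fun (2 * x - 1) + 2^-1.

Definition b_inv_fun y : R :=
  if y < 2^-1 then y else 2^-1 * a_inv_fun (2 * y - 1) + 2^-1.

Lemma a_fun_itv x : 0 <= x <= 1 -> 0 <= a_fun x <= 1.
Proof. by rewrite /a_fun; case: ltP => ?; [|case: ltP => ?]; lra. Qed.

Lemma a_inv_fun_itv y : 0 <= y <= 1 -> 0 <= a_inv_fun y <= 1.
Proof. by rewrite /a_inv_fun; case: ltP => ?; [|case: ltP => ?]; lra. Qed.

Lemma b_fun_itv x : 0 <= x <= 1 -> 0 <= b_fun x <= 1.
Proof.
rewrite /b_fun; case: ltP => // hx x01.
have /a_fun_itv : 0 <= 2 * x - 1 <= 1 by lra.
by lra.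
Qed.

Lemma b_inv_fun_itv y : 0 <= y <= 1 -> 0 <= b_inv_fun y <= 1.
Proof.
rewrite /b_inv_fun; case: ltP => // hy y01.
have /a_inv_fun_itv : 0 <= 2 * y - 1 <= 1 by lra.
by lra.
Qed.

Lemma a_funK : cancel a_fun a_inv_fun.
Proof.
move=> x; rewrite /a_fun.
by case: (ltP x) => ?; [|case: (ltP x) => ?]; rewrite /a_inv_fun;
  (case: ltP => ?; [|case: ltP => ?]); lra.
Qed.

Lemma a_inv_funK : cancel a_inv_fun a_fun.
Proof.
move=> y; rewrite /a_inv_fun.
by case: (ltP y) => ?; [|case: (ltP y) => ?]; rewrite /a_fun;
  (case: ltP => ?; [|case: ltP => ?]); lra.
Qed.

Lemma b_funK x : 0 <= x <= 1 -> b_inv_fun (b_fun x) = x.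
Proof.
move=> x01; rewrite /b_fun; case: (ltP x 2^-1) => hx.
  by rewrite /b_inv_fun hx.
have x'01 : 0 <= 2 * x - 1 <= 1 by lra.
have := a_fun_itv x'01; rewrite /b_inv_fun; case: ltP => [|_ _]; first by lra.
have -> : 2 * (2^-1 * a_fun (2 * x - 1) + 2^-1) - 1 = a_fun (2 * x - 1) by lra.
by rewrite a_funK; lra.
Qed.

Lemma b_inv_funK y : 0 <= y <= 1 -> b_fun (b_inv_fun y) = y.
Proof.
move=> y01; rewrite /b_inv_fun; case: (ltP y 2^-1) => hy.
  by rewrite /b_fun hy.
have y'01 : 0 <= 2 * y - 1 <= 1 by lra.
have := a_inv_fun_itv y'01; rewrite /b_fun; case: ltP => [|_ _]; first by lra.
have -> : 2 * (2^-1 * a_inv_fun (2 * y - 1) + 2^-1) - 1 = a_inv_fun (2 * y - 1).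
  by lra.
by rewrite a_inv_funK; lra.
Qed.

Definition gen_a (x : unit_itv R) : unit_itv R :=
  exist _ (a_fun (val x)) (a_fun_itv (valP x)).
Definition gen_a_inv (x : unit_itv R) : unit_itv R :=
  exist _ (a_inv_fun (val x)) (a_inv_fun_itv (valP x)).
Definition gen_b (x : unit_itv R) : unit_itv R :=
  exist _ (b_fun (val x)) (b_fun_itv (valP x)).
Definition gen_b_inv (x : unit_itv R) : unit_itv R :=
  exist _ (b_inv_fun (val x)) (b_inv_fun_itv (valP x)).

Lemma gen_aK : cancel gen_a gen_a_inv.
Proof. by move=> x; apply: val_inj; rewrite /= a_funK. Qed.

Lemma gen_a_invK : cancel gen_a_inv gen_a.
Proof. by move=> x; apply: val_inj; rewrite /= a_inv_funK. Qed.

Lemma gen_bK : cancel gen_b gen_b_inv.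
Proof. by move=> x; apply: val_inj; rewrite /= b_funK ?(valP x). Qed.

Lemma gen_b_invK : cancel gen_b_inv gen_b.
Proof. by move=> x; apply: val_inj; rewrite /= b_inv_funK ?(valP x). Qed.

(* The group of bijections of [0, 1] generated by a and b, as a set of maps.
   Since a and b are homeomorphisms, so are all its members. *)
Inductive thompsonF : set (unit_itv R -> unit_itv R) :=
| thompsonF_id : thompsonF id
| thompsonF_a : thompsonF gen_a
| thompsonF_b : thompsonF gen_b
| thompsonF_comp g h : thompsonF g -> thompsonF h -> thompsonF (g \o h)
| thompsonF_inv g h :
    thompsonF g -> cancel g h -> cancel h g -> thompsonF h.

Lemma half_itv : 0 <= (2^-1 : R) <= 1.
Proof. by lra. Qed.

Definition half : unit_itv R := exist _ 2^-1 half_itv.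

Definition orbit_half : set (unit_itv R) := [set g half | g in thompsonF].

Definition gens : seq (unit_itv R -> unit_itv R) :=
  [:: gen_a; gen_a_inv; gen_b; gen_b_inv].

Definition step_prob (x y : unit_itv R) : R :=
  \sum_(s <- gens) if s x == y then 4^-1 else 0.

(* n-step transition probabilities on the orbit (Chapman-Kolmogorov). The sum
   over the orbit is the finitely supported one: for each x there are at most
   four y with step_prob x y != 0, so it is never the default value 0 that such
   a sum takes on an infinite support. *)
Fixpoint nstep_prob (n : nat) (x z : unit_itv R) : R :=
  if n is m.+1 then \sum_(y \in orbit_half) step_prob x y * nstep_prob m y z
  else if x == z then 1 else 0.

Definition return_prob (n : nat) : R := nstep_prob n half half.

End Generators.

(* Main.v *)
Require Import Defs.
From HB Require Import structures.
From mathcomp Require Import all_boot all_order all_algebra.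
From mathcomp Require Import all_classical all_reals all_analysis.
From mathcomp Require Import zify ring lra.
Import Order.TTheory GRing.Theory Num.Theory.
Import numFieldNormedType.Exports.
Local Open Scope classical_set_scope.
Local Open Scope ring_scope.

Set Implicit Arguments.
Unset Strict Implicit.
Unset Printing Implicit Defensive.

(* The Schreier graph is, up to loops and double edges, a tree: a binary spine
   with a ray attached to each spine vertex, the rays being of two kinds. Let r,
   d be the first-passage generating functions along the two kinds of rays, and
   x, y those from the two kinds of spine vertices to their parents. With
   t = z/4 they satisfy r = t(1+r)^2, d = 2t(1+d^2), x = t(1+(r+x+y)x),
   y = t(1+(x+2d)y), and the return generating function is given by
   G = 1 + t(r+y+2)G. Explicitly r and d involve only the square roots of 1 - z
   and 1 - z^2, so n r_n and n d_n are of the form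
     (alpha + beta (-1)^n) n^(-1/2) + O(n^-1).
   The spine is transient: x(1) <= 3/5 and y(1) <= 5/7, so that the Jacobian of
   the system for x, y has norm < 1. This yields x_n, y_n, G_n = O(n^(-3/2)),
   a condition stable under products and under inversion of 1 - th for h >= 0
   with h(1) < 4. Differentiating the system turns it into a linear one and
   expresses n G_n as the convolution of O(n^(-3/2)) sequences with n r_n and
   n d_n, and such convolutions preserve the displayed form. *)

(** * Formal power series *)

Definition fps (R : comNzRingType) : Type := nat -> R.

Section FpsRing.
Variable R : comNzRingType.
Implicit Types a b c : fps R.

HB.instance Definition _ := Choice.on (fps R).
HB.instance Definition _ := GRing.Zmodule.on (fps R).

Definition fps_one : fps R := fun n => (n == 0)%:R.
Definition fps_mul a b : fps R := fun n => \sum_(k < n.+1) a k * b (n - k)%N.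

(** Coefficients up to [n] of a product depend only on those of the factors, so the ring laws are
    inherited from polynomials by truncation. *)
Let trunc n a : {poly R} := \poly_(k < n.+1) a k.

Let coef_trunc n a k : (k <= n)%N -> (trunc n a)`_k = a k.
Proof. by rewrite coef_poly ltnS => ->. Qed.

Let trunc_mul n a b k : (k <= n)%N -> (trunc n a * trunc n b)`_k = fps_mul a b k.
Proof.
move=> kn; rewrite coefM; apply: eq_bigr => i _.
by rewrite !coef_trunc// (leq_trans _ kn)// ?leq_subr// -ltnS.
Qed.

Lemma fps_mulC : commutative fps_mul.
Proof. by move=> a b; apply/funext => n; rewrite -!(trunc_mul _ _ (leqnn n)) mulrC. Qed.

Lemma fps_mulA : associative fps_mul.
Proof.
move=> a b c; apply/funext => n.
transitivity (trunc n a * (trunc n b * trunc n c))`_n.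
  rewrite coefM; apply: eq_bigr => i _.
  by rewrite coef_trunc ?trunc_mul ?leq_subr// -ltnS.
rewrite mulrA coefM; apply: eq_bigr => i _.
by rewrite coef_trunc ?trunc_mul ?leq_subr// -ltnS.
Qed.

Lemma fps_mul1 : left_id fps_one fps_mul.
Proof.
move=> a; apply/funext => n; rewrite /fps_mul big_ord_recl/= subn0 mul1r.
by rewrite big1 ?addr0// => i _; rewrite mul0r.
Qed.

Lemma fps_mulD : left_distributive fps_mul +%R.
Proof.
move=> a b c; apply/funext => n; rewrite -[RHS]big_split/=.
by apply: eq_bigr => i _; rewrite -mulrDl.
Qed.

Lemma fps_one_neq0 : fps_one != 0.
Proof. by apply/eqP => /(congr1 (@^~ 0%N)) /eqP; rewrite /fps_one oner_eq0. Qed.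

HB.instance Definition _ := GRing.Zmodule_isComNzRing.Build (fps R)
  fps_mulA fps_mulC fps_mul1 fps_mulD fps_one_neq0.

Lemma fpsD a b n : (a + b) n = a n + b n. Proof. by []. Qed.
Lemma fpsN a n : (- a) n = - a n. Proof. by []. Qed.
Lemma fpsM a b n : (a * b) n = \sum_(k < n.+1) a k * b (n - k)%N.
Proof. by []. Qed.
Lemma fps0 n : (0 : fps R) n = 0. Proof. by []. Qed.
Lemma fps1 n : (1 : fps R) n = (n == 0)%:R. Proof. by []. Qed.

Lemma fps_natM m a n : (m%:R * a) n = m%:R * a n.
Proof.
rewrite !mulr_natl; elim: m => [|m IH]; first by rewrite !mulr0n.
by rewrite !mulrS fpsD IH.
Qed.

(** The Euler derivation z d/dz. *)
Definition theta a : fps R := fun n => n%:R * a n.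

Lemma thetaD a b : theta (a + b) = theta a + theta b.
Proof. by apply/funext => n; rewrite /theta /= mulrDr. Qed.

Lemma theta1 : theta 1 = 0.
Proof. by apply/funext => -[|n]; rewrite /theta fps1 ?mul0r ?mulr0. Qed.

Lemma thetaN a : theta (- a) = - theta a.
Proof. by apply/funext => n; rewrite /theta fpsN mulrN. Qed.

Lemma thetaM a b : theta (a * b) = theta a * b + a * theta b.
Proof.
apply/funext => n; rewrite /theta fpsD !fpsM mulr_sumr -big_split/=.
apply: eq_bigr => i _.
rewrite -[in n%:R](@subnK i n) ?natrD; last by rewrite -ltnS.
ring.
Qed.
End FpsRing.

(** * Mass bounds and X-adic fixpoints *)

Section Mass.
Variable R : realType.
Implicit Types (a b : fps R) (p q : R).

(* z / 4, the weight of a step by one of the four generators. *)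
Definition qX : fps R := fun n => (n == 1)%:R / 4.

Lemma qX0 a : (qX * a) 0 = 0.
Proof. by rewrite fpsM big_ord1/= /qX !mul0r. Qed.

Lemma qXS a n : (qX * a) n.+1 = a n / 4.
Proof.
rewrite fpsM big_ord_recl big_ord_recl/= /qX !mul0r add0r/= subn1/=.
by rewrite big1 => [|i _]; rewrite ?mul0r// addr0 mulrC mul1r.
Qed.

Lemma theta_qX : theta qX = qX.
Proof.
apply/funext => -[|[|n]]; rewrite /theta /qX ?mul0r ?mul1r//=.
by rewrite mulr0.
Qed.

(** Nonnegative coefficients with value at most [q] at z = 1, stated through partial sums so that no
    convergence has to be discussed. *)
Definition mass_le q a : Prop :=
  (forall n, 0 <= a n) /\ forall n, \sum_(k < n) a k <= q.

Lemma mass_ge0 q a : mass_le q a -> 0 <= q.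
Proof. by case=> _ /(_ 0%N); rewrite big_ord0. Qed.

Lemma mass_leW p q a : p <= q -> mass_le p a -> mass_le q a.
Proof. by move=> pq [a0 ap]; split=> // n; exact: le_trans (ap n) pq. Qed.

Lemma mass0 q : 0 <= q -> mass_le q 0.
Proof. by move=> q0; split=> // n; rewrite big1. Qed.

Lemma mass1 : mass_le 1 1.
Proof.
split=> [n|[|n]]; rewrite ?ler0n ?big_ord0//.
by rewrite big_ord_recl/= big1 ?addr0.
Qed.

Lemma massD p q a b : mass_le p a -> mass_le q b -> mass_le (p + q) (a + b).
Proof.
move=> [a0 ap] [b0 bq]; split=> n; first by rewrite fpsD addr_ge0.
by rewrite big_split; apply: lerD.
Qed.

(** The partial sum of the product runs over a triangle of index pairs, which lies inside the square
    given by the product of the partial sums. *)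
Lemma massM p q a b : mass_le p a -> mass_le q b -> mass_le (p * q) (a * b).
Proof.
move=> [a0 ap] [b0 bq]; split=> n.
  by rewrite fpsM sumr_ge0// => i _; rewrite mulr_ge0.
apply: (@le_trans _ _ ((\sum_(k < n) a k) * \sum_(k < n) b k)); last first.
  by apply: ler_pM => //; rewrite sumr_ge0.
rewrite mulr_suml.
under eq_bigr => i _ do rewrite fpsM.
have -> : \sum_(i < n) \sum_(k < i.+1) a k * b (i - k)%N =
          \sum_(k < n) \sum_(i < n | (k <= i)%N) a k * b (i - k)%N.
  rewrite (exchange_big_dep predT)//=; apply: eq_bigr => i _.
  by rewrite (big_ord_widen n (fun k => a k * b (i - k)%N)).
apply: ler_sum => k _; rewrite -mulr_sumr ler_wpM2l//.
rewrite -(big_mkord (fun i => (k <= i)%N) (fun i => b (i - k)%N)).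
rewrite (big_cat_nat (n := k))//=; last exact: ltnW.
rewrite big_nat_cond big1 ?add0r => [|i /andP[/andP[_ ik]]]; last by rewrite leqNgt ik.
rewrite -{1}[k : nat]add0n big_addn big_mkcond/= big_mkord.
apply: (@le_trans _ _ (\sum_(i < n - k) b i)).
  by apply: ler_sum => i _; rewrite leq_addl addnK.
rewrite -[leRHS](big_mkord xpredT b) (big_cat_nat (n := (n - k)%N))//= ?leq_subr//.
by rewrite big_mkord lerDl sumr_ge0.
Qed.

Lemma mass_qX q a : mass_le q a -> mass_le (q / 4) (qX * a).
Proof.
move=> [a0 aq]; split=> [[|n]|[|n]].
- by rewrite qX0.
- by rewrite qXS divr_ge0.
- by rewrite big_ord0 divr_ge0// (@mass_ge0 _ a).
rewrite big_ord_recl qX0 add0r.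
under eq_bigr => i _ do rewrite qXS.
by rewrite -mulr_suml ler_pM2r.
Qed.

Definition agree n a b := forall k, (k < n)%N -> a k = b k.

Lemma agree_refl n a : agree n a a. Proof. by []. Qed.

Lemma agreeD n a b a' b' : agree n a a' -> agree n b b' ->
  agree n (a + b) (a' + b').
Proof. by move=> aa bb k kn; rewrite !fpsD aa ?bb. Qed.

Lemma agreeM n a b a' b' : agree n a a' -> agree n b b' ->
  agree n (a * b) (a' * b').
Proof.
move=> aa bb k kn; rewrite !fpsM; apply: eq_bigr => i _.
by rewrite aa ?bb// ?(leq_ltn_trans (leq_subr _ _))// (leq_ltn_trans _ kn)// -ltnS.
Qed.

Lemma agree_qX n a b : agree n a b -> agree n.+1 (qX * a) (qX * b).
Proof. by move=> ab [|k] kn; rewrite ?qX0// !qXS ab. Qed.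

(* [f] and [g] are contractions for the X-adic distance, and mass bounds pass
   to X-adic limits. *)
Lemma fps_fixpoint2 p q (f g : fps R -> fps R -> fps R) :
  0 <= p -> 0 <= q ->
  (forall n a b a' b', agree n a a' -> agree n b b' ->
     agree n.+1 (f a b) (f a' b') /\ agree n.+1 (g a b) (g a' b')) ->
  (forall a b, mass_le p a -> mass_le q b ->
     mass_le p (f a b) /\ mass_le q (g a b)) ->
  exists a b, [/\ mass_le p a, mass_le q b, a = f a b & b = g a b].
Proof.
move=> p0 q0 contr pres.
pose F (ab : fps R * fps R) := (f ab.1 ab.2, g ab.1 ab.2).
pose u n := iter n F (0, 0).
have uP n : mass_le p (u n).1 /\ mass_le q (u n).2.
  elim: n => [|n [IH1 IH2]]; first by split; exact: mass0.
  exact: pres.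
have uE m n : agree n (u n).1 (u (n + m)%N).1 /\ agree n (u n).2 (u (n + m)%N).2.
  elim: n => [|n [IH1 IH2]]; first by split.
  exact: contr.
(* Coefficient [k] no longer changes from iterate [k.+1] on, so the limit is read off diagonally. *)
pose a : fps R := fun k => (u k.+1).1 k.
pose b : fps R := fun k => (u k.+1).2 k.
have aE n : agree n a (u n).1.
  by move=> k kn; rewrite -(subnKC kn) -(uE (n - k.+1)%N k.+1).1.
have bE n : agree n b (u n).2.
  by move=> k kn; rewrite -(subnKC kn) -(uE (n - k.+1)%N k.+1).2.
have mass_lim r (c : fps R) v : (forall n, agree n c (v n)) ->
    (forall n, mass_le r (v n)) -> mass_le r c.
  move=> cv vr; split=> n; first by rewrite (cv n.+1)// (vr _).1.
  rewrite (eq_bigr (fun k : 'I_n => v n k)) ?(vr _).2// => k _.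
  by rewrite (cv n).
exists a, b; split.
- by apply: (mass_lim _ _ (fun n => (u n).1)) => // n; case: (uP n).
- by apply: (mass_lim _ _ (fun n => (u n).2)) => // n; case: (uP n).
- apply/funext => n; rewrite (aE n.+1)//.
  by have [E _] := contr _ _ _ _ _ (aE n) (bE n); rewrite E.
- apply/funext => n; rewrite (bE n.+1)//.
  by have [_ E] := contr _ _ _ _ _ (aE n) (bE n); rewrite E.
Qed.

(** The series [k] is 1 / (1 - X a), and its mass bound is the fixpoint of m = 1 + q m / 4. The
    second component of the fixpoint is a dummy. *)
Lemma fps_geom q a : q < 4 -> mass_le q a ->
  exists2 k, mass_le (1 - q / 4)^-1 k & k = 1 + qX * (a * k).
Proof.
move=> q4 aq; have q41 : 0 < 1 - q / 4 by lra.
have [||||k [_ [kq _ kE _]]] := @fps_fixpoint2 (1 - q / 4)^-1 0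
  (fun k _ => 1 + qX * (a * k)) (fun _ _ => 0).
- by rewrite invr_ge0 ltW.
- by [].
- move=> n b _ b' _ bb _; split=> //.
  by apply: agreeD => //; apply: agree_qX; apply: agreeM.
- move=> b _ bq _; split; last exact: mass0.
  apply: mass_leW (massD mass1 (mass_qX (massM aq bq))).
  suff -> : 1 + q * (1 - q / 4)^-1 / 4 = (1 - q / 4)^-1 by [].
  by field; rewrite lt0r_neq0//; lra.
by exists k.
Qed.
End Mass.

(** * Convolution of powers of n^(-1/2) *)

Section Weights.
Variable R : realType.
Implicit Types (a b : fps R) (n k : nat).

(** The weight n^(-1/2), shifted by one so as to be positive at n = 0. *)
Definition w n : R := (Num.sqrt n.+1%:R)^-1.

Lemma w_gt0 n : 0 < w n.
Proof. by rewrite invr_gt0 sqrtr_gt0 ltr0n. Qed.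

Lemma w_ge0 n : 0 <= w n. Proof. exact/ltW/w_gt0. Qed.

Lemma w_sqr n : w n ^+ 2 = n.+1%:R^-1.
Proof. by rewrite exprVn sqr_sqrtr. Qed.

Lemma ler_w m n : (m <= n)%N -> w n <= w m.
Proof.
by move=> mn; rewrite lef_pV2 ?posrE ?sqrtr_gt0 ?ltr0n// ler_wsqrtr// ler_nat.
Qed.

Lemma w0 : w 0 = 1. Proof. by rewrite /w sqrtr1 invr1. Qed.

Lemma w_le1 n : w n <= 1.
Proof. by rewrite -w0 ler_w. Qed.

Lemma w_small (e : R) : 0 < e -> exists m, w m ^+ 2 <= e.
Proof.
move=> e0; exists (Num.truncn e^-1); rewrite w_sqr invf_ple ?posrE ?ltr0n//.
exact/ltW/truncnS_gt.
Qed.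

Lemma sum_w n : \sum_(k < n) w k <= 2 * Num.sqrt n%:R.
Proof.
elim: n => [|n IH]; first by rewrite big_ord0 mulr_ge0.
rewrite big_ord_recr/=; apply: le_trans (lerD IH (lexx _)) _.
have := w_gt0 n; rewrite /w; set s := Num.sqrt n.+1%:R; set u := Num.sqrt _.
rewrite invr_gt0 => s0; have u0 : 0 <= u by exact: sqrtr_ge0.
have su : s ^+ 2 = u ^+ 2 + 1 by rewrite !sqr_sqrtr// natr1.
rewrite -(ler_pM2r s0) mulrDl mulVf ?gt_eqF//.
have : 0 <= (s - u) ^+ 2 by exact: sqr_ge0.
nra.
Qed.

(** Discrete form of d(n^(-1/2)) = - n^(-3/2) / 2 dn; it makes sums of [w ^+ 3] telescope. *)
Lemma w3_telescope n : w n.+1 ^+ 3 <= 2 * (w n - w n.+1).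
Proof.
have a0 := w_gt0 n; have b0 := w_gt0 n.+1; have ba := ler_w (leqnSn n).
have : w n.+1 ^+ 2 + w n ^+ 2 * w n.+1 ^+ 2 = w n ^+ 2.
  rewrite !w_sqr -[n.+2%:R]natr1; have : 0 < n.+1%:R :> R by [].
  by move: (n.+1%:R) => x x0; field; rewrite !lt0r_neq0//; lra.
move: (w n) (w n.+1) a0 b0 ba => a b a0 b0 ba E.
(* a^2 b^2 = (a - b)(a + b) and a + b <= 2a *)
have : a * (a * b ^+ 2) <= a * (2 * (a - b)) by nra.
rewrite ler_pM2l// => H; apply: le_trans H.
by rewrite (exprS b 2) ler_wpM2r// sqr_ge0.
Qed.

Lemma sum_w3 n : \sum_(k < n) w k ^+ 3 <= 3.
Proof.
suff H m : \sum_(k < m.+1) w k ^+ 3 <= 3 - 2 * w m.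
  case: n => [|n]; first by rewrite big_ord0.
  by apply: le_trans (H n) _; have := w_gt0 n; lra.
elim: m => [|m IH]; first by rewrite big_ord_recl big_ord0 w0; lra.
by rewrite big_ord_recr/=; have := w3_telescope m; lra.
Qed.

(** This is n + 2 = (k + 1) + (n - k + 1) divided by the product of the three terms. *)
Lemma w_pythagoras n k : (k <= n)%N ->
  w n.+1 ^+ 2 * (w k ^+ 2 + w (n - k)%N ^+ 2) = w k ^+ 2 * w (n - k)%N ^+ 2.
Proof.
move=> kn; rewrite !w_sqr.
have -> : n.+2%:R = k.+1%:R + (n - k)%N.+1%:R :> R.
  by rewrite -natrD addSn addnS subnKC.
have : 0 < k.+1%:R :> R by []; have : 0 < (n - k).+1%:R :> R by [].
move: (k.+1%:R) ((n - k).+1%:R) => x y x0 y0.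
by field; rewrite !lt0r_neq0//; lra.
Qed.

(** Square root of [w_pythagoras], with a^2 + b^2 <= (a + b)^2. It pulls [w n.+1] out of a
    convolution and leaves single sums. *)
Lemma w_conv_le n k : (k <= n)%N ->
  w k * w (n - k)%N <= w n.+1 * (w k + w (n - k)%N).
Proof.
move=> /w_pythagoras; have := w_gt0 n.+1; have := w_gt0 k; have := w_gt0 (n - k).
move: (w k) (w (n - k)%N) (w n.+1) => a b c b0 a0 c0 E.
rewrite -(ler_pXn2r (n := 2)) ?nnegrE//; last 2 first.
- by rewrite mulr_ge0 ?ltW.
- by rewrite mulr_ge0 ?addr_ge0 ?ltW.
rewrite !exprMn -E ler_wpM2l ?sqr_ge0//.
by have := mulr_gt0 a0 b0; nra.
Qed.

Lemma sum_rev n (f : nat -> R) :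
  \sum_(k < n.+1) f (n - k)%N = \sum_(k < n.+1) f k.
Proof.
rewrite (reindex_inj rev_ord_inj)/=; apply: eq_bigr => i _.
by rewrite subSS subKn// -ltnS.
Qed.

Lemma sum_w_w n : \sum_(k < n.+1) w k * w (n - k)%N <= 4.
Proof.
apply: (@le_trans _ _ (w n.+1 * (\sum_(k < n.+1) (w k + w (n - k)%N)))).
  by rewrite mulr_sumr; apply: ler_sum => k _; rewrite w_conv_le// -ltnS.
rewrite big_split/= sum_rev; have := sum_w n.+1.
set S := \sum_(k < n.+1) _ => HS.
have := w_gt0 n; have := w_gt0 n.+1; have := ler_w (leqnSn n).
have : w n * Num.sqrt n.+1%:R = 1 by rewrite mulVf// gt_eqF// sqrtr_gt0 ltr0n.
set s := Num.sqrt _ in HS * => E le c0 w0.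
have s0 : 0 <= s by exact: sqrtr_ge0.
apply: (@le_trans _ _ (w n.+1 * (4 * s))); first by rewrite ler_pM2l//; lra.
by rewrite mulrCA -[leRHS]mulr1 ler_pM2l// -E ler_wpM2r.
Qed.

Lemma sum_w3_w3 n :
  \sum_(k < n.+1) w k ^+ 3 * w (n - k)%N ^+ 3 <= 24 * w n.+1 ^+ 3.
Proof.
apply: (@le_trans _ _
    (4 * w n.+1 ^+ 3 * (\sum_(k < n.+1) (w k ^+ 3 + w (n - k)%N ^+ 3)))).
  rewrite mulr_sumr; apply: ler_sum => k _.
  have := @w_conv_le n k; rewrite -ltnS ltn_ord => /(_ isT).
  have := w_gt0 n.+1; have := w_gt0 k; have := w_gt0 (n - k).
  move: (w k) (w (n - k)%N) (w n.+1) => a b c b0 a0 c0 H.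
  rewrite -exprMn; apply: (@le_trans _ _ ((c * (a + b)) ^+ 3)).
    by rewrite lerXn2r// nnegrE ?mulr_ge0 ?addr_ge0// ltW.
  rewrite exprMn (_ : 4 * _ * _ = c ^+ 3 * (4 * (a ^+ 3 + b ^+ 3))); last by ring.
  rewrite ler_wpM2l ?exprn_ge0 ?(ltW c0)//.
  (* 4 (a^3 + b^3) - (a + b)^3 = 3 (a + b) (a - b)^2. *)
  have : 0 <= (a + b) * (a - b) ^+ 2 by rewrite mulr_ge0 ?sqr_ge0// addr_ge0// ltW.
  by nra.
rewrite big_split/= (sum_rev _ (fun k => w k ^+ 3)).
have := sum_w3 n.+1; have : 0 < w n.+1 ^+ 3 by rewrite exprn_gt0 ?w_gt0.
by set S := \sum_(k < _) _; nra.
Qed.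

Lemma sum_w3_w2 n :
  \sum_(k < n.+1) w k ^+ 3 * w (n - k)%N ^+ 2 <= 7 * w n.+1 ^+ 2.
Proof.
apply: (@le_trans _ _
    (w n.+1 ^+ 2 * (\sum_(k < n.+1) (w k ^+ 3 + w k * w (n - k)%N)))).
  rewrite mulr_sumr; apply: ler_sum => k _.
  have := @w_pythagoras n k; rewrite -ltnS ltn_ord => /(_ isT).
  have := w_le1 (n - k); have := w_gt0 k; have := w_gt0 (n - k).
  move: (w k) (w (n - k)%N) (w n.+1) => a b c b0 a0 b1 H.
  have -> : a ^+ 3 * b ^+ 2 = c ^+ 2 * (a ^+ 3 + a * b ^+ 2).
    transitivity (a * (a ^+ 2 * b ^+ 2)); first by ring.
    by rewrite -H; ring.
  rewrite ler_wpM2l ?sqr_ge0// lerD2l ler_pM2l//; nra.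
rewrite big_split/= mulrC ler_pM2r ?exprn_gt0 ?w_gt0//.
by have := sum_w3 n.+1; have := sum_w_w n; lra.
Qed.

(** The assumption reads k + 1 <= e (n - k + 1), whence n + 2 <= (1 + e) (n - k + 1). The exponent
    3/2 of 1 + e is rounded up to 2. *)
Lemma w_ratio n k (e : R) : (k <= n)%N -> 0 <= e ->
  w (n - k)%N ^+ 2 <= e * w k ^+ 2 ->
  w (n - k)%N ^+ 3 <= (1 + e) ^+ 2 * w n.+1 ^+ 3.
Proof.
move=> kn e0; have := w_pythagoras kn.
have := w_gt0 n.+1; have := w_gt0 k; have := w_gt0 (n - k).
move: (w k) (w (n - k)%N) (w n.+1) => a b c b0 a0 c0 E bea.
have H : b ^+ 2 <= (1 + e) * c ^+ 2.
  rewrite -(ler_pM2l (exprn_gt0 2 a0)) -E.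
  by have : 0 < c ^+ 2 by [rewrite exprn_gt0]; nra.
have b_le : b <= (1 + e) * c.
  rewrite -(ler_pXn2r (n := 2)) ?nnegrE ?(ltW b0)//; last first.
    by rewrite mulr_ge0 ?(ltW c0)//; lra.
  by apply: le_trans H _; have : 0 < c ^+ 2 by [rewrite exprn_gt0]; nra.
rewrite exprS (_ : _ * c ^+ 3 = ((1 + e) * c) * ((1 + e) * c ^+ 2)); last by ring.
by apply: ler_pM => //; rewrite ?sqr_ge0 ?ltW.
Qed.

(** * Dominated convergence for convolutions *)

Lemma mass_tail (q e : R) a : mass_le q a -> 0 < e ->
  exists N, forall M, \sum_(k < M | (N <= k)%N) a k <= e.
Proof.
move=> [a0 aq] e0; pose S := [set \sum_(k < n) a k | n in [set: nat]].
have supS : has_sup S.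
  split; first by exists (\sum_(k < 0) a k); exists 0%N.
  by exists q => _ [n _ <-].
have [_ [N _ <-] HN] := sup_adherent e0 supS; exists N => M.
have [MN|NM] := leqP M N.
  rewrite big1 ?ltW// => i Ni.
  by have := leq_trans (ltn_ord i) (leq_trans MN Ni); rewrite ltnn.
have : \sum_(k < M) a k <= sup S.
  by apply: ub_le_sup; [case: supS|exists M].
rewrite (bigID (fun k : 'I_M => (N <= k)%N))/=.
have -> : \sum_(k < M | ~~ (N <= k)%N) a k = \sum_(k < N) a k.
  rewrite (big_ord_widen M a (ltnW NM)).
  by apply: eq_bigl => k; rewrite ltnNge.
lra.
Qed.

(* Dominated convergence: for [2 k <= n] the ratio [(w (n - k) / w n.+1) ^+ 3]
   is bounded, and it tends to 1 for each fixed [k]. *)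
Lemma half_conv_le (q e : R) a : mass_le q a -> 0 < e ->
  exists n0, forall n, (n0 <= n)%N ->
    \sum_(k < n.+1 | (2 * k <= n)%N) a k * w (n - k)%N ^+ 3
      <= (q + e) * w n.+1 ^+ 3.
Proof.
move=> aq e0; have q0 := mass_ge0 aq; have [a0 aqs] := aq.
have e8 : 0 < e / 8 by lra.
have [N HN] := mass_tail aq e8.
(* As d <= 1, (1 + d)^2 q <= q + 3 d q <= q + e / 2; the indices [k >= N] contribute at most 4 (e /
   8), the other half of [e]. *)
pose d := Num.min 1 (e / (6 * (q + 1))).
have d0 : 0 < d by rewrite lt_min ltr01 divr_gt0//; lra.
have d1 : d <= 1 by rewrite ge_min lexx.
have dq : 6 * d * q <= e.
  have : d * (6 * (q + 1)) <= e.
    by rewrite -ler_pdivlMr; [rewrite ge_min lexx orbT|lra].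
  nra.
have dN : 0 < d * w N ^+ 2 by rewrite mulr_gt0 ?exprn_gt0 ?w_gt0.
have [m Hm] := w_small dN.
exists (N + m)%N => n Nmn; set c := w n.+1 ^+ 3.
have c0 : 0 < c by rewrite exprn_gt0 ?w_gt0.
apply: (@le_trans _ _ (\sum_(k < n.+1)
    ((1 + d) ^+ 2 * c * a k + (if (N <= k)%N then 4 * c * a k else 0)))).
  rewrite big_mkcond/=; apply: ler_sum => k _.
  have kn : (k <= n)%N by rewrite -ltnS.
  case: ifPn => [k2|_]; last first.
    by rewrite addr_ge0//; [|case: ifP => // _];
      rewrite mulr_ge0// mulr_ge0 ?sqr_ge0 ?ltW.
  case: ifPn => [Nk|]; last first.
    rewrite -ltnNge addr0 mulrC => kN; rewrite ler_wpM2r// w_ratio ?(ltW d0)//.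
    apply: (@le_trans _ _ (w m ^+ 2)).
      by rewrite lerXn2r ?nnegrE ?w_ge0// ler_w//; lia.
    apply: le_trans Hm _; rewrite ler_pM2l//.
    by rewrite lerXn2r ?nnegrE ?w_ge0// ler_w// ltnW.
  rewrite -[leLHS]add0r; apply: lerD.
    by rewrite mulr_ge0// mulr_ge0 ?sqr_ge0 ?ltW.
  rewrite mulrC ler_wpM2r// (_ : 4 * c = (1 + 1) ^+ 2 * c) ?w_ratio//; last by ring.
  by rewrite mul1r lerXn2r ?nnegrE ?w_ge0// ler_w//; lia.
rewrite big_split/= -mulr_sumr -big_mkcond/= -mulr_sumr.
have := HN n.+1; have := aqs n.+1; have : 0 <= \sum_(k < n.+1) a k.
  exact: sumr_ge0.
set S1 := \sum_(k < _) _; set S2 := \sum_(k < _ | _) _ => S0 H1 H2.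
have : (1 + d) ^+ 2 * S1 <= q + e / 2.
  apply: (@le_trans _ _ ((1 + d) ^+ 2 * q)); first by rewrite ler_wpM2l ?sqr_ge0.
  nra.
nra.
Qed.

(** The convolution is split in the middle: in each half the factor of large index takes its
    pointwise bound and the other one contributes its mass. For use in inductions, [n0] is
    independent of [C] and [D], and the bounds are only assumed up to [n]. *)
Lemma conv_le (p q e : R) a b : mass_le p a -> mass_le q b -> 0 < e ->
  exists n0, forall n (C D : R), (n0 <= n)%N ->
    (forall k, (k <= n)%N -> a k <= C * w k ^+ 3) ->
    (forall k, (k <= n)%N -> b k <= D * w k ^+ 3) ->
    0 <= C -> 0 <= D ->
    (a * b) n <= ((p + e) * D + (q + e) * C) * w n.+1 ^+ 3.
Proof.
move=> ap bq e0.
have [n1 H1] := half_conv_le ap e0; have [n2 H2] := half_conv_le bq e0.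
exists (maxn n1 n2) => n C D; rewrite geq_max => /andP[/H1 {}H1 /H2 {}H2] aC bD C0 D0.
have [a0 _] := ap; have [b0 _] := bq.
rewrite fpsM (bigID (fun k : 'I_n.+1 => (2 * k <= n)%N))/= mulrDl; apply: lerD.
  apply: (@le_trans _ _ (D * \sum_(k < n.+1 | (2 * k <= n)%N) a k * w (n - k)%N ^+ 3)).
    rewrite mulr_sumr; apply: ler_sum => k _.
    by rewrite mulrCA ler_wpM2l// bD// leq_subr.
  by rewrite [(_ + _) * D]mulrC -mulrA ler_wpM2l.
apply: (@le_trans _ _ (C * \sum_(k < n.+1 | (2 * k <= n)%N) b k * w (n - k)%N ^+ 3)).
  rewrite mulr_sumr (reindex_inj rev_ord_inj)/= big_mkcond [leRHS]big_mkcond/=.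
  apply: ler_sum => k _; have kn : (k <= n)%N by rewrite -ltnS.
  rewrite subSS subKn//; case: ifPn => [k1|_].
    rewrite ifT; last by lia.
    by rewrite mulrC mulrCA ler_wpM2l// aC// leq_subr.
  by case: ifP => // _; rewrite !mulr_ge0 ?exprn_ge0 ?w_ge0.
by rewrite [(_ + _) * C]mulrC -mulrA ler_wpM2l.
Qed.

End Weights.

(** * Sequences O(n^(-3/2)) *)

Section Rough.
Variable R : realType.
Implicit Types (a b : fps R) (n k : nat).
Notation w := (@w R).

Definition rough a := exists C, forall n, `|a n| <= C * w n ^+ 3.

Lemma rough_cst_ge0 (v : nat -> R) (C : R) m :
  (forall n, `|v n| <= C * w n ^+ m) -> 0 <= C.
Proof.
by move=> /(_ 0%N); rewrite w0 expr1n mulr1; apply: le_trans.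
Qed.

Lemma roughD a b : rough a -> rough b -> rough (a + b).
Proof.
move=> [C aC] [D bD]; exists (C + D) => n.
by rewrite fpsD mulrDl (le_trans (ler_normD _ _))// lerD.
Qed.

Lemma roughM a b : rough a -> rough b -> rough (a * b).
Proof.
move=> [C aC] [D bD]; exists (24 * (C * D)) => n.
have C0 := rough_cst_ge0 aC; have D0 := rough_cst_ge0 bD.
rewrite fpsM; apply: le_trans (ler_norm_sum _ _ _) _.
apply: (@le_trans _ _ (C * D * \sum_(k < n.+1) w k ^+ 3 * w (n - k)%N ^+ 3)).
  rewrite mulr_sumr; apply: ler_sum => k _.
  by rewrite normrM mulrACA ler_pM.
rewrite (_ : 24 * _ * _ = C * D * (24 * w n ^+ 3)); last by ring.
rewrite ler_wpM2l ?mulr_ge0//.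
apply: le_trans (sum_w3_w3 R n) _; rewrite ler_wpM2l//.
by rewrite lerXn2r ?nnegrE ?w_ge0// ler_w.
Qed.

Lemma rough1 : rough 1.
Proof.
exists 1 => n; rewrite mul1r fps1; case: n => [|n]; rewrite ?w0 ?expr1n ?normr1//.
by rewrite normr0 exprn_ge0 ?w_ge0.
Qed.

Lemma rough_qX : rough (qX R).
Proof.
exists (w 1 ^+ 3)^-1 => n; rewrite /qX.
have [->|_] := eqVneq n 1%N; last first.
  by rewrite mul0r normr0 mulr_ge0 ?invr_ge0 ?exprn_ge0 ?w_ge0.
by rewrite mulVf ?expf_neq0 ?gt_eqF ?w_gt0//= mulr1n ger0_norm; lra.
Qed.

(** Strong induction: in the constant [C], the sum [S] takes care of the indices up to [n0], and the
    term in [c] ensures q C + c <= C. *)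
Lemma le_of_eventual_step (u : nat -> R) (q c : R) n0 : q < 1 ->
  (forall n C, (n0 <= n)%N -> 0 <= C ->
     (forall k, (k <= n)%N -> u k <= C * w k ^+ 3) ->
     u n.+1 <= (q * C + c) * w n.+1 ^+ 3) ->
  exists2 C, 0 <= C & forall n, u n <= C * w n ^+ 3.
Proof.
move=> q1 H; pose S := \sum_(k < n0.+1) `|u k| / w k ^+ 3.
have w3 k : 0 < w k ^+ 3 by rewrite exprn_gt0 ?w_gt0.
have S0 : 0 <= S by apply: sumr_ge0 => k _; rewrite divr_ge0 ?(ltW (w3 _)).
have c0 : 0 <= `|c| / (1 - q) by rewrite divr_ge0//; lra.
pose C := S + `|c| / (1 - q); have C0 : 0 <= C by exact: addr_ge0.
exists C => // n; elim/ltn_ind: n => n IH.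
have [nn0|n0n] := leqP n n0.
  apply: le_trans (ler_norm _) _; rewrite -ler_pdivrMr// ler_wpDr//.
  rewrite /S (bigD1 (Ordinal (nn0 : (n < n0.+1)%N)))//= lerDl sumr_ge0// => k _.
  by rewrite divr_ge0 ?(ltW (w3 _)).
case: n n0n IH => // n n0n IH; apply: le_trans (H n C n0n C0 _) _.
  by move=> k kn; exact: IH.
rewrite ler_pM2r//.
suff : c <= (1 - q) * C by lra.
rewrite mulrDr mulrC [in X in _ + X]mulrC divfK; last by rewrite gt_eqF//; lra.
by have := ler_norm c; have : 0 <= S * (1 - q) by [rewrite mulr_ge0//; lra]; lra.
Qed.

Lemma rough_le a : (forall n, 0 <= a n) ->
  (exists2 C, 0 <= C & forall n, a n <= C * w n ^+ 3) -> rough a.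
Proof. by move=> a0 [C _ aC]; exists C => n; rewrite ger0_norm. Qed.

Lemma rough_bound a : rough a ->
  exists2 C, 0 <= C & forall n, a n <= C * w n ^+ 3.
Proof.
move=> [C aC]; exists C; first exact: rough_cst_ge0 aC.
by move=> n; apply: le_trans (ler_norm _) _.
Qed.

(** By [conv_le], one step of the recursion multiplies a bound on [b] by nearly q / 4 < 1 and adds a
    term governed by the bound on [a]. *)
Lemma rough_geom (p q : R) a b : q < 4 -> mass_le q a -> mass_le p b ->
  rough a -> b = 1 + qX R * (a * b) -> rough b.
Proof.
move=> q4 aq bp /rough_bound[D D0 aD] bE; apply: rough_le; first by case: bp.
have q0 := mass_ge0 aq; have e0 : 0 < (4 - q) / 2 by lra.
have [n0 H] := conv_le aq bp e0.
apply: (@le_of_eventual_step _ ((q + (4 - q) / 2) / 4)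
  ((p + (4 - q) / 2) * D / 4) n0); first by lra.
move=> n C n0n C0 bC; rewrite bE fpsD fps1 add0r qXS.
have := H n D C n0n (fun k _ => aD k) bC D0 C0.
by lra.
Qed.

(* The linearization of the recursion has coefficients (1 + 2x + y, x)/4 and
   (y, x + 2)/4, both of sum < 1 at the masses [3 / 5] and [5 / 7], so that
   [max x_n y_n] can be bounded by induction. *)
Lemma rough_hitting r d x y :
  mass_le 1 r -> mass_le 1 d -> mass_le (3 / 5) x -> mass_le (5 / 7) y ->
  rough r -> rough d ->
  x = qX R * (1 + (r + x + y) * x) -> y = qX R * (1 + (x + d + d) * y) ->
  rough x /\ rough y.
Proof.
move=> r1 d1 x1 y1 /rough_bound[Cr Cr0 rC] /rough_bound[Cd Cd0 dC] xE yE.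
(* With five convolutions in the recursion for [x], this error gives the rate (1 + 3 (3/5) + 5/7 +
   5/20) / 4 < 95/100; the rate for [y] is smaller. *)
have e0 : 0 < 20^-1 :> R by lra.
have [nrx Hrx] := conv_le r1 x1 e0; have [nxx Hxx] := conv_le x1 x1 e0.
have [nyx Hyx] := conv_le y1 x1 e0; have [nxy Hxy] := conv_le x1 y1 e0.
have [ndy Hdy] := conv_le d1 y1 e0.
pose u n := Num.max (x n) (y n).
suff [C C0 uC] : exists2 C, 0 <= C & forall n, u n <= C * w n ^+ 3.
  split; apply: rough_le; rewrite ?(proj1 x1) ?(proj1 y1)//.
  - by case: x1.
  - by exists C => // n; apply: le_trans (uC n); rewrite le_max lexx.
  - by case: y1.
  - by exists C => // n; apply: le_trans (uC n); rewrite le_max lexx orbT.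
apply: (@le_of_eventual_step u (95 / 100) (Cr + Cd)
  (1 + (nrx + nxx + nyx + nxy + ndy))); first by lra.
move=> n C nn C0 uC.
have xC k : (k <= n)%N -> x k <= C * w k ^+ 3.
  by move=> /uC; apply: le_trans; rewrite le_max lexx.
have yC k : (k <= n)%N -> y k <= C * w k ^+ 3.
  by move=> /uC; apply: le_trans; rewrite le_max lexx orbT.
have := Hrx n Cr C _ (fun k _ => rC k) xC Cr0 C0.
have := Hxx n C C _ xC xC C0 C0.
have := Hyx n C C _ yC xC C0 C0.
have := Hxy n C C _ xC yC C0 C0.
have := Hdy n Cd C _ (fun k _ => dC k) yC Cd0 C0.
move=> /(_ ltac:(lia)) + /(_ ltac:(lia)) + /(_ ltac:(lia)) + /(_ ltac:(lia)) +
  /(_ ltac:(lia)).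
have n0 : (1 : fps R) n = 0 by rewrite fps1; case: eqP => //; lia.
have xS : x n.+1 = ((r * x) n + (x * x) n + (y * x) n) / 4.
  by rewrite {1}xE qXS fpsD n0 add0r !mulrDl.
have yS : y n.+1 = ((x * y) n + (d * y) n + (d * y) n) / 4.
  by rewrite {1}yE qXS fpsD n0 add0r !mulrDl.
rewrite /u xS yS.
have : 0 < w n.+1 ^+ 3 by rewrite exprn_gt0 ?w_gt0.
move: (w n.+1 ^+ 3) => W W0.
have := mulr_ge0 C0 (ltW W0); have := mulr_ge0 Cr0 (ltW W0).
have := mulr_ge0 Cd0 (ltW W0); rewrite ge_max => ? ? ? *.
by apply/andP; split; lra.
Qed.

End Rough.

(** * Asymptotics of the form (alpha + beta (-1)^n) n^(-1/2) + O(n^-1) *)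

Section Tame.
Variable R : realType.
Implicit Types (a b : fps R) (n k : nat).
Notation w := (@w R).

(** The intervals of centre [s n] and radius [e n] are nested; [L] is the supremum of their left
    ends. *)
Lemma nested_limit (s e : nat -> R) :
  (forall n, `|s n.+1 - s n| <= e n - e n.+1) -> (forall n, 0 <= e n) ->
  exists L, forall n, `|s n - L| <= e n.
Proof.
move=> H e0.
have mono m n : (m <= n)%N -> `|s n - s m| <= e m - e n.
  move=> mn; rewrite -(subnKC mn); elim: (n - m)%N => [|k IH].
    by rewrite addn0 !subrr normr0.
  have := H (m + k)%N; rewrite addnS; move: IH.
  by rewrite !ler_norml => /andP[? ?] /andP[? ?]; apply/andP; split; lra.
pose S := [set s n - e n | n in [set: nat]].
have ubS m : ubound S (s m + e m).
  move=> _ [n _ <-]; have := e0 m; have := e0 n.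
  have [/mono|/ltnW/mono] := leqP m n; rewrite ler_norml => /andP[? ?] *; lra.
have supS : has_sup S.
  by split; [exists (s 0%N - e 0%N); exists 0%N|exists (s 0%N + e 0%N)].
exists (sup S) => n; rewrite distrC ler_norml.
have : s n - e n <= sup S by apply: ub_le_sup; [case: supS|exists n].
have : sup S <= s n + e n by apply: ge_sup; [case: supS|].
by move=> ? ?; apply/andP; split; lra.
Qed.

Lemma rough_partial_sum a : rough a ->
  exists L C, forall n, `|\sum_(k < n.+1) a k - L| <= C * w n.
Proof.
move=> [C aC]; have C0 := rough_cst_ge0 aC.
have [||L HL] := @nested_limit (fun n => \sum_(k < n.+1) a k) (fun n => 2 * C * w n).
- move=> n; rewrite big_ord_recr/= addrAC subrr add0r.
  apply: le_trans (aC _) _; have := w3_telescope R n; nra.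
- by move=> n; rewrite !mulr_ge0 ?w_ge0.
by exists L, (2 * C).
Qed.

(** Cost of replacing [w (n - k)] by [w n] against a rough sequence; summed over [k] with [sum_w_w]
    it is O(n^-1). The identity [E] comes from (k + 1) + (n - k + 1) - 1 = n + 1 and controls the
    difference of squares. *)
Lemma w_increment n k : (k <= n)%N ->
  w k ^+ 3 * `|w (n - k)%N - w n| <= w n ^+ 2 * (w k * w (n - k)%N).
Proof.
move=> kn; have := ler_w R (leq_subr k n); have := w_gt0 R n; have := w_gt0 R k.
have := w_gt0 R (n - k)%N; move=> b0 a0 c0 cb.
have E : w k ^+ 2 * w (n - k)%N ^+ 2 + w k ^+ 2 * w (n - k)%N ^+ 2 * w n ^+ 2 =
    w (n - k)%N ^+ 2 * w n ^+ 2 + w k ^+ 2 * w n ^+ 2.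
  rewrite !w_sqr.
  have -> : n.+1%:R = k.+1%:R + (n - k)%N.+1%:R - 1 :> R.
    by rewrite -natrD addSn addnS subnKC// -[n.+2%:R]natr1 addrK.
  have : 1 <= k.+1%:R :> R by rewrite ler1n.
  have : 1 <= (n - k).+1%:R :> R by rewrite ler1n.
  move: (k.+1%:R) ((n - k).+1%:R) => x y x0 y0.
  by field; rewrite !lt0r_neq0//; lra.
rewrite ger0_norm ?subr_ge0//.
move: (w (n - k)%N) (w n) (w k) b0 c0 a0 cb E => b c a b0 c0 a0 cb E.
have H : a ^+ 2 * (b - c) <= c ^+ 2 * b.
  rewrite -(ler_pM2r (addr_gt0 b0 c0)).
  have : 0 <= c ^+ 3 * b by rewrite mulr_ge0 ?exprn_ge0 ?ltW.
  have : 0 <= a ^+ 2 * b ^+ 2 * c ^+ 2 by rewrite !mulr_ge0 ?exprn_ge0 ?ltW.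
  by lra.
rewrite exprS -mulrA [leRHS]mulrCA ler_pM2l//.
Qed.

(** Here [L] is the sum of [a]. The error splits into the increments of [w] and the tail of that
    sum. *)
Lemma rough_mul_w a : rough a ->
  exists L C, forall n, `|(a * (w : fps R)) n - L * w n| <= C * w n ^+ 2.
Proof.
move=> ra; have [L [C HL]] := rough_partial_sum ra; have [D aD] := ra.
have D0 := rough_cst_ge0 aD.
exists L, (4 * D + C) => n.
have -> : (a * (w : fps R)) n - L * w n =
    \sum_(k < n.+1) a k * (w (n - k)%N - w n) +
    (\sum_(k < n.+1) a k - L) * w n.
  rewrite fpsM mulrBl addrA mulr_suml -big_split/=; congr (_ - _).
  by apply: eq_bigr => k _; ring.
rewrite [leRHS]mulrDl; apply: le_trans (ler_normD _ _) _; apply: lerD; last first.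
  by rewrite normrM (ger0_norm (w_ge0 R n)) expr2 mulrA ler_wpM2r ?w_ge0.
apply: le_trans (ler_norm_sum _ _ _) _.
apply: (@le_trans _ _ (D * w n ^+ 2 * \sum_(k < n.+1) w k * w (n - k)%N)).
  rewrite mulr_sumr; apply: ler_sum => k _; rewrite normrM -mulrA.
  apply: (@le_trans _ _ (D * (w k ^+ 3 * `|w (n - k)%N - w n|))).
    by rewrite mulrA ler_wpM2r.
  by rewrite ler_wpM2l// w_increment// -ltnS.
rewrite (_ : 4 * D * _ = D * w n ^+ 2 * 4); last by ring.
by rewrite ler_wpM2l ?sum_w_w// mulr_ge0 ?sqr_ge0.
Qed.

Lemma rough_mul_w2 a b (C : R) : rough a -> (forall n, `|b n| <= C * w n ^+ 2) ->
  exists D, forall n, `|(a * b) n| <= D * w n ^+ 2.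
Proof.
move=> [D aD] bC; have D0 := rough_cst_ge0 aD; have C0 := rough_cst_ge0 bC.
exists (7 * (D * C)) => n.
rewrite fpsM; apply: le_trans (ler_norm_sum _ _ _) _.
apply: (@le_trans _ _ (D * C * \sum_(k < n.+1) w k ^+ 3 * w (n - k)%N ^+ 2)).
  rewrite mulr_sumr; apply: ler_sum => k _.
  by rewrite normrM mulrACA ler_pM.
rewrite (_ : 7 * _ * _ = D * C * (7 * w n ^+ 2)); last by ring.
rewrite ler_wpM2l ?mulr_ge0//.
apply: le_trans (sum_w3_w2 R n) _; rewrite ler_wpM2l//.
by rewrite lerXn2r ?nnegrE ?w_ge0// ler_w.
Qed.

(** The substitution of -z for z, a ring involution that exchanges the singularities at 1 and -1. *)
Definition twist a : fps R := fun n => (-1) ^+ n * a n.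

Lemma twistM a b : twist (a * b) = twist a * twist b.
Proof.
apply/funext => n; rewrite /twist !fpsM mulr_sumr; apply: eq_bigr => k _.
have kn : (k <= n)%N by rewrite -ltnS.
by rewrite -{1}(subnKC kn) exprD; ring.
Qed.

Lemma twistK : involutive twist.
Proof.
by move=> a; apply/funext => n; rewrite /twist mulrA -exprMn mulrNN mulr1 expr1n mul1r.
Qed.

Lemma norm_twist a n : `|twist a n| = `|a n|.
Proof. by rewrite /twist normrM normrX normrN1 expr1n mul1r. Qed.

Lemma rough_twist a : rough a -> rough (twist a).
Proof. by move=> [C aC]; exists C => n; rewrite norm_twist. Qed.

Definition tame a := exists al be C, forall n,
  `|a n - (al + be * (-1) ^+ n) * w n| <= C * w n ^+ 2.

Lemma tameD a b : tame a -> tame b -> tame (a + b).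
Proof.
move=> [al [be [C aC]]] [al' [be' [D bD]]]; exists (al + al'), (be + be'), (C + D) => n.
rewrite [leRHS]mulrDl fpsD.
apply: le_trans (lerD (aC n) (bD n)); apply: le_trans (ler_normD _ _).
by rewrite (_ : a n + b n - _ = a n - (al + be * (-1) ^+ n) * w n +
  (b n - (al' + be' * (-1) ^+ n) * w n)); last by ring.
Qed.

Lemma rough_tame a : rough a -> tame a.
Proof.
move=> [C aC]; exists 0, 0, C => n; rewrite !(mul0r, addr0, subr0).
apply: le_trans (aC n) _; rewrite ler_wpM2l ?(rough_cst_ge0 aC)//.
by rewrite exprSr ler_piMr ?sqr_ge0 ?w_le1.
Qed.

(** The non-oscillating part of [b] is handled by [rough_mul_w], the part in (-1)^n by the same
    lemma after twisting, and the remainder [e] by [rough_mul_w2]. *)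
Lemma rough_tameM a b : rough a -> tame b -> tame (a * b).
Proof.
move=> ra [al [be [C bC]]].
pose e : fps R := fun n => b n - (al + be * (-1) ^+ n) * w n.
have [E aeE] := @rough_mul_w2 a e C ra bC.
have [L [D aD]] := rough_mul_w ra.
have [L' [D' aD']] := rough_mul_w (rough_twist ra).
exists (al * L), (be * L'), (`|al| * D + `|be| * D' + E) => n.
have -> : (a * b) n = al * (a * (w : fps R)) n +
    be * ((-1) ^+ n * (twist a * (w : fps R)) n) + (a * e) n.
  rewrite -[(-1) ^+ n * _]/(twist _ n) twistM twistK !fpsM !mulr_sumr -!big_split/=.
  by apply: eq_bigr => k _; rewrite /e /twist; ring.
have -> : al * (a * (w : fps R)) n + be * ((-1) ^+ n * (twist a * (w : fps R)) n) +
    (a * e) n - (al * L + be * L' * (-1) ^+ n) * w n =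
  al * ((a * (w : fps R)) n - L * w n) +
  be * ((-1) ^+ n * ((twist a * (w : fps R)) n - L' * w n)) + (a * e) n by ring.
rewrite [leRHS]mulrDl (mulrDl (`|al| * D)).
apply: le_trans (ler_normD _ _) _; apply: lerD => //.
apply: le_trans (ler_normD _ _) _; apply: lerD; rewrite !normrM -mulrA ler_wpM2l//.
by rewrite normrX normrN1 expr1n mul1r.
Qed.

Lemma tame_theta a (al be C : R) :
  (forall n, `|a n - (al + be * (-1) ^+ n) * w n ^+ 3| <= C * w n ^+ 4) ->
  tame (theta a).
Proof.
move=> aC; exists al, be, (C + (`|al| + `|be|)) => n; rewrite /theta.
have C0 := rough_cst_ge0 aC.
have nw : n%:R * w n ^+ 2 = 1 - w n ^+ 2.
  rewrite w_sqr -[n.+1%:R]natr1; have : 0 <= n%:R :> R by [].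
  by move: (n%:R) => x x0; field; rewrite gt_eqF//; lra.
have -> : n%:R * a n - (al + be * (-1) ^+ n) * w n =
    n%:R * (a n - (al + be * (-1) ^+ n) * w n ^+ 3) -
    (al + be * (-1) ^+ n) * w n * w n ^+ 2.
  by ring: nw.
rewrite [leRHS]mulrDl; apply: le_trans (ler_normB _ _) _; apply: lerD.
  rewrite normrM normr_nat; apply: (@le_trans _ _ (C * w n ^+ 2 * (n%:R * w n ^+ 2))).
    rewrite (_ : C * _ * _ = n%:R * (C * w n ^+ 4)); last by ring.
    by rewrite ler_wpM2l.
  rewrite nw; apply: ler_piMr; last by rewrite gerBl sqr_ge0.
  by rewrite mulr_ge0// sqr_ge0.
rewrite 2!normrM (ger0_norm (sqr_ge0 _)) ler_wpM2r ?sqr_ge0//.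
rewrite (ger0_norm (w_ge0 _ _)) -[leRHS]mulr1 ler_pM ?w_le1 ?w_ge0//.
apply: le_trans (ler_normD _ _) _; rewrite lerD2l normrM.
by rewrite normrX normrN1 expr1n mulr1.
Qed.

Lemma rough_of_asymptotic a (al be C : R) :
  (forall n, `|a n - (al + be * (-1) ^+ n) * w n ^+ 3| <= C * w n ^+ 4) ->
  rough a.
Proof.
move=> aC; exists (C + (`|al| + `|be|)) => n; have C0 := rough_cst_ge0 aC.
have w30 : 0 <= w n ^+ 3 by rewrite exprn_ge0 ?w_ge0.
rewrite -[a n](subrK ((al + be * (-1) ^+ n) * w n ^+ 3)) [leRHS]mulrDl.
apply: le_trans (ler_normD _ _) _; apply: lerD.
  by apply: le_trans (aC n) _; rewrite ler_wpM2l// exprSr ler_piMr// w_le1.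
rewrite normrM (ger0_norm w30) ler_wpM2r//.
apply: le_trans (ler_normD _ _) _; rewrite lerD2l normrM.
by rewrite normrX normrN1 expr1n mulr1.
Qed.

(* The recurrence satisfied by the coefficients of (1 - X)^(1/2): the squares
   of the ratios of [s n.+1 * (n.+1)^(3/2)] are 1 + O(n^-2). *)
Lemma half_power_asymptotic (s : nat -> R) :
  (forall n, n.+1%:R * s n.+1 = (n%:R - 2^-1) * s n) ->
  exists L C, forall n, `|s n.+1 - L * w n ^+ 3| <= C * w n ^+ 4.
Proof.
(* Starting at [s 1] avoids the negative factor n - 1/2 at n = 0, so that all the ratios below are
   nonnegative. *)
move=> sE; pose v n := s n.+1 / w n ^+ 3.
have w3 n : 0 < w n ^+ 3 by rewrite exprn_gt0 ?w_gt0.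
have ratio n : exists q : R, [/\ 0 <= q, q <= 1, v n.+1 = q * v n &
    1 - q <= 3 / 2 * (n.+1%:R^-1 - n.+2%:R^-1)].
  exists ((n%:R + 2^-1) / n.+2%:R * (w n / w n.+1) ^+ 3).
  set q := _ * _.
  have m0 : 0 <= n%:R :> R by [].
  have q0 : 0 <= q.
    apply: mulr_ge0; last by rewrite exprn_ge0// divr_ge0// w_ge0.
    by rewrite divr_ge0//; lra.
  (* Squaring removes the square roots and leaves a rational function of n. *)
  have q2 : q ^+ 2 = (n%:R + 2^-1) ^+ 2 * n.+2%:R / n.+1%:R ^+ 3.
    rewrite /q exprMn (exprAC _ 3) (exprMn _ (w n)) (exprVn (w n.+1)) !w_sqr.
    rewrite -[n.+2%:R]natr1 -[n.+1%:R]natr1; move: (n%:R) m0 => x x0.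
    by field; rewrite !gt_eqF//; lra.
  have q2' : 1 - q ^+ 2 = (3 * n.+1%:R - 1) / (4 * n.+1%:R ^+ 3).
    rewrite q2 -[n.+2%:R]natr1 -[n.+1%:R]natr1; move: (n%:R) m0 => x x0.
    by field; rewrite !gt_eqF//; lra.
  have m1 : 1 <= n.+1%:R :> R by rewrite ler1n.
  have q21 : q ^+ 2 <= 1.
    rewrite -subr_ge0 q2' divr_ge0 ?mulr_ge0 ?exprn_ge0//; lra.
  have q1 : q <= 1 by rewrite -(ler_pXn2r (n := 2)) ?nnegrE// expr1n.
  split => //.
    rewrite /v /q exprMn (exprVn (w n.+1)).
    have -> : s n.+2 = (n%:R + 2^-1) / n.+2%:R * s n.+1.
      apply: (@mulfI _ n.+2%:R); rewrite ?pnatr_eq0// sE -natr1.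
      by rewrite [RHS]mulrA [n.+2%:R * _]mulrC divfK ?pnatr_eq0//; congr (_ * _); lra.
    by field; rewrite !gt_eqF ?w_gt0// -?natrD ?ltr0n.
  (* As 0 <= q <= 1, 1 - q <= 1 - q^2, which is O(n^-2) and is put below a telescoping difference,
     as [nested_limit] requires. *)
  apply: (@le_trans _ _ (1 - q ^+ 2)); first by rewrite lerD2l lerN2 expr2 ler_piMl.
  rewrite q2' -[n.+2%:R]natr1.
  move: (n.+1%:R) m1 => m m1.
  rewrite (_ : _^-1 - _^-1 = (m * (m + 1))^-1); last first.
    by field; rewrite !gt_eqF//; lra.
  have m0' : 0 < m by lra.
  rewrite ler_pdivrMr ?mulr_gt0 ?exprn_gt0//.
  rewrite (_ : 3 / 2 / _ * _ = 6 * m ^+ 2 / (m + 1)); last first.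
    by field; rewrite !gt_eqF//; lra.
  by rewrite ler_pdivlMr; nra.
have v0 n : `|v n| <= `|v 0%N|.
  elim: n => // n; apply: le_trans; have [q [q0 q1 -> _]] := ratio n.
  by rewrite normrM (ger0_norm q0) ler_piMl.
have [||L HL] := @nested_limit v (fun n => 3 / 2 * `|v 0%N| * n.+1%:R^-1).
- move=> n; have [q [q0 q1 -> Hq]] := ratio n.
  rewrite -mulrBr -{2}[v n]mul1r -mulrBl normrM distrC.
  have d0 : 0 <= 1 - q by rewrite subr_ge0.
  by rewrite (ger0_norm d0) [leRHS]mulrAC; apply: ler_pM.
- by move=> n; rewrite mulr_ge0.
exists L, (3 / 2 * `|v 0%N|) => n.
rewrite (_ : s n.+1 = v n * w n ^+ 3); last by rewrite divfK ?gt_eqF.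
rewrite -mulrBl normrM (ger0_norm (ltW (w3 n))).
rewrite mulrC; apply: (@le_trans _ _ (w n ^+ 3 * (3 / 2 * `|v 0%N| * w n ^+ 2))).
  by rewrite w_sqr ler_wpM2l// ltW.
rewrite mulrCA ler_wpM2l ?mulr_ge0// -exprD.
by rewrite (exprSr _ 4) ler_piMr ?w_le1// exprn_ge0// w_ge0.
Qed.

End Tame.

(** * The Schreier graph *)

Section Walk.
Variable R : realType.
Implicit Types (p : unit_itv R) (F : fps R).

Lemma orbit_gens p (s : unit_itv R -> unit_itv R) :
  s \in gens R -> orbit_half p -> orbit_half (s p).
Proof.
move=> sg [g Fg <-]; exists (s \o g) => //; apply: thompsonF_comp => //.
move: sg; rewrite !inE => /or4P[] /eqP ->.
- exact: thompsonF_a.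
- exact: thompsonF_inv (thompsonF_a R) (@gen_aK R) (@gen_a_invK R).
- exact: thompsonF_b.
- exact: thompsonF_inv (thompsonF_b R) (@gen_bK R) (@gen_b_invK R).
Qed.

(** The support of the sum is the set of images of [p] under the generators; [undup] lists each
    image once, and coinciding images add up their weights. *)
Lemma step_sum p (f : unit_itv R -> R) : orbit_half p ->
  \sum_(q \in @orbit_half R) step_prob p q * f q =
  (f (gen_a p) + f (gen_a_inv p) + f (gen_b p) + f (gen_b_inv p)) / 4.
Proof.
move=> Op.
pose S := undup [seq s p | s <- gens R].
have SO q : q \in S -> orbit_half q.
  by rewrite mem_undup => /mapP[s sg ->]; exact: orbit_gens.
rewrite (fsbigE (undup [seq s p | s <- gens R])) ?undup_uniq//; last first.
  move=> q _ qS; rewrite /step_prob big_seq big1 ?mul0r// => s sg.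
  case: eqP => // E; move: qS; rewrite -E mem_undup => /negP[].
  exact: map_f.
rewrite big_seq_cond (eq_bigl (fun q => q \in S)) -?big_seq; last first.
  by move=> q; apply/andP/idP => [[]//|qS]; split=> //; rewrite inE; exact: SO.
under eq_bigr => q _ do rewrite /step_prob mulr_suml.
rewrite exchange_big/=.
rewrite (eq_big_seq (fun s => 4^-1 * f (s p))); last first.
  move=> s sg; have sS : s p \in S by rewrite mem_undup map_f.
  rewrite (bigD1_seq _ sS) ?undup_uniq//= eqxx big1 ?addr0// => q.
  by rewrite eq_sym => /negbTE ->; rewrite mul0r.
by rewrite !big_cons big_nil; ring.
Qed.

Inductive node := Root | NodeA | NodeB.

(* The Schreier graph is a tree (up to loops and double edges) made of a binary
   spine with a ray attached to each of its vertices. [spine k p F] says that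
   [p] is a spine vertex of type [k] and that [F] is the generating function of
   the first passage from [p] to 1/2. Vertices of types [Root] and [NodeA] carry
   a ray with loops, those of type [NodeB] a ray with double edges. *)
Inductive spine (x y : fps R) : node -> unit_itv R -> fps R -> Prop :=
| spine_root : spine x y Root (Defs.half R) 1
| spine_rootB : spine x y NodeB (gen_a_inv (Defs.half R)) y
| spine_AA p F : spine x y NodeA p F -> spine x y NodeA (gen_b p) (x * F)
| spine_BA p F : spine x y NodeB p F -> spine x y NodeA (gen_b p) (x * F)
| spine_AB p F : spine x y NodeA p F -> spine x y NodeB (gen_a_inv p) (y * F).

(** Each step outward along a ray multiplies the first-passage series by [r] or [d]. At n = 0 these
    are the spine vertices themselves. *)
Inductive vertex (r d x y : fps R) : unit_itv R -> fps R -> Prop :=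
| vertex_lazy k n p F : spine x y k p F -> k <> NodeB ->
    vertex r d x y (iter n (@gen_a R) p) (r ^+ n * F)
| vertex_double n p F : spine x y NodeB p F ->
    vertex r d x y (iter n (@gen_a_inv R) p) (d ^+ n * F).

(** * Position of the vertices in the unit interval *)

Lemma a_fun_lo (v : R) : v < 2^-1 -> a_fun v = v / 2.
Proof. by rewrite /a_fun => ->. Qed.

Lemma a_fun_mid (v : R) : 2^-1 <= v < 3 / 4 -> a_fun v = v - 4^-1.
Proof. by rewrite /a_fun leNgt => /andP[/negbTE -> ->]. Qed.

Lemma a_fun_hi (v : R) : 3 / 4 <= v -> a_fun v = 2 * v - 1.
Proof. by move=> h; rewrite /a_fun !ifN// -leNgt//; lra. Qed.

Lemma a_inv_fun_hi (v : R) : 2^-1 <= v -> a_inv_fun v = (v + 1) / 2.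
Proof. by move=> h; rewrite /a_inv_fun !ifN// -leNgt//; lra. Qed.

Lemma b_fun_hi (v : R) : 2^-1 <= v -> b_fun v = 2^-1 * a_fun (2 * v - 1) + 2^-1.
Proof. by move=> h; rewrite /b_fun ifN// -leNgt. Qed.

Lemma b_inv_fun_hi (v : R) :
  2^-1 <= v -> b_inv_fun v = 2^-1 * a_inv_fun (2 * v - 1) + 2^-1.
Proof. by move=> h; rewrite /b_inv_fun ifN// -leNgt. Qed.

(** These intervals decide which affine pieces of the generators apply at a spine vertex, and
    separate the other types from the root. *)
Lemma spine_range x y k p F : spine x y k p F ->
  match k with
  | Root => p = Defs.half R
  | NodeA => 2^-1 < val p < 3 / 4
  | NodeB => 3 / 4 <= val p < 7 / 8
  end.
Proof.
elim=> //=.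
- by rewrite a_inv_fun_hi; lra.
- by move=> {F}q F _ /andP[? ?]; rewrite b_fun_hi ?a_fun_lo; lra.
- by move=> {F}q F _ /andP[? ?]; rewrite b_fun_hi ?a_fun_mid; lra.
- by move=> {F}q F _ /andP[? ?]; rewrite a_inv_fun_hi; lra.
Qed.

Lemma spine_parentA x y p F : spine x y NodeA p F ->
  exists k F', spine x y k (gen_b_inv p) F' /\ F = x * F'.
Proof.
by move E : NodeA => k sp; case: sp E => // {}p {}F sp _;
  rewrite gen_bK; [exists NodeA, F|exists NodeB, F].
Qed.

Lemma spine_parentB x y p F : spine x y NodeB p F ->
  exists k F', [/\ spine x y k (gen_a p) F', k <> NodeB & F = y * F'].
Proof.
move E : NodeB => k sp; case: sp E => // [_|{}p {}F sp _]; rewrite gen_a_invK.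
  by exists Root, 1; split; rewrite ?mulr1//; exact: spine_root.
by exists NodeA, F.
Qed.

(** Below 1/2 the generator [b] is the identity, whence the loops. *)
Lemma lazy_ray x y k p F n : spine x y k p F -> k <> NodeB ->
  0 < val (iter n.+1 (@gen_a R) p) < 2^-1.
Proof.
move=> sp kB; elim: n => [|n /= /andP[v0 v1]]; last by rewrite a_fun_lo; lra.
have pmid : 2^-1 <= val p < 3 / 4.
  by case: k sp kB => // /spine_range => [->/=|/andP[/ltW -> ->]//]; lra.
by rewrite /= a_fun_mid//; move: pmid => /= ?; lra.
Qed.

Lemma double_ray x y p F n : spine x y NodeB p F ->
  3 / 4 <= val (iter n (@gen_a_inv R) p).
Proof.
move=> sp; elim: n => [|n /= ?]; first by case/andP: (spine_range sp).
by rewrite a_inv_fun_hi; lra.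
Qed.

(** From 7/8 on, [b] agrees with [a], and from 3/4 on their inverses agree, whence the double
    edges. *)
Lemma double_ray_ge78 x y p F n : spine x y NodeB p F ->
  7 / 8 <= val (iter n.+1 (@gen_a_inv R) p).
Proof. by move=> /(double_ray n) /= ?; rewrite a_inv_fun_hi; lra. Qed.

Lemma gen_b_lt_half p : val p < 2^-1 -> gen_b p = p.
Proof. by move=> ph; apply: val_inj; rewrite /= /b_fun ph. Qed.

Lemma gen_b_inv_lt_half p : val p < 2^-1 -> gen_b_inv p = p.
Proof. by move=> ph; apply: val_inj; rewrite /= /b_inv_fun ph. Qed.

Lemma gen_b_ge78 p : 7 / 8 <= val p -> gen_b p = gen_a p.
Proof.
move=> /= ph; apply: val_inj; rewrite /= b_fun_hi; last lra.
by rewrite !a_fun_hi; lra.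
Qed.

Lemma gen_b_inv_ge34 p : 3 / 4 <= val p -> gen_b_inv p = gen_a_inv p.
Proof.
move=> /= ph; apply: val_inj; rewrite /= b_inv_fun_hi; last lra.
by rewrite !a_inv_fun_hi; lra.
Qed.

Lemma gen_b_half : gen_b (Defs.half R) = Defs.half R.
Proof. by apply: val_inj; rewrite /= b_fun_hi ?a_fun_lo; lra. Qed.

Lemma gen_b_inv_half : gen_b_inv (Defs.half R) = Defs.half R.
Proof. by rewrite -{1}gen_b_half gen_bK. Qed.

Lemma vertex_spineA r d x y k p F : k <> NodeB -> spine x y k p F ->
  vertex r d x y p F.
Proof. by move=> kB /(vertex_lazy r d 0); rewrite expr0 mul1r; apply. Qed.

Lemma vertex_spineB r d x y p F : spine x y NodeB p F -> vertex r d x y p F.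
Proof. by move=> /(vertex_double r d 0); rewrite expr0 mul1r. Qed.

(** First-step analysis of the passage from [p] to 1/2 followed by returns. The equation used is
    that of [G] at the root, of [x] at [NodeA], of [r] inside a lazy ray, of [y] at [NodeB] and of
    [d] inside a double ray, in this order. *)
Lemma vertex_step r d x y G p F :
  r = qX R * (1 + r + r + r ^+ 2) -> d = qX R * (1 + 1 + d ^+ 2 + d ^+ 2) ->
  x = qX R * (1 + (r + x + y) * x) -> y = qX R * (1 + (x + d + d) * y) ->
  G = 1 + qX R * ((r + y + 1 + 1) * G) ->
  vertex r d x y p F ->
  exists F1 F2 F3 F4,
    [/\ [/\ vertex r d x y (gen_a p) F1, vertex r d x y (gen_a_inv p) F2,
            vertex r d x y (gen_b p) F3 & vertex r d x y (gen_b_inv p) F4] &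
        F * G = (p == Defs.half R)%:R + qX R * ((F1 + F2 + F3 + F4) * G)].
Proof.
move=> rE dE xE yE GE [k [|n] {}p {}F sp kB|[|n] {}p {}F sp].
- have ray := vertex_lazy r d 1 sp kB; rewrite expr1 in ray.
  rewrite expr0 mul1r /=; case: k sp kB ray => // sp _ ray.
    have sp1 := vertex_spineB r d (spine_rootB x y).
    have sp0 := vertex_spineA r d (_ : Root <> NodeB) (spine_root x y).
    have pE := spine_range sp; move: sp ray; rewrite {}pE => sp ray.
    have F1 : F = 1.
      move E : Root sp => k0; move E' : (Defs.half R) => p0 sp.
      by case: sp E => //.
    move: ray; rewrite F1 mulr1 => ray.
    exists r, y, 1, 1; rewrite gen_b_half gen_b_inv_half eqxx; split.
      by split => //; exact: sp0.
    by rewrite mul1r {1}GE.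
  have [k' [F' [sp' FE]]] := spine_parentA sp.
  have ph : p != Defs.half R.
    have /andP[h _] := spine_range sp.
    by apply: contraTneq h => ->; rewrite /= ltxx.
  exists (r * F), (y * F), (x * F), F'; split; first split.
  + exact: ray.
  + exact: vertex_spineB (spine_AB sp).
  + exact: vertex_spineA (spine_AA sp).
  + by case: k' sp' => sp'; [exact: vertex_spineA sp'|exact: vertex_spineA sp'|
      exact: vertex_spineB sp'].
  rewrite (negbTE ph) mulr0n add0r FE {1}xE; ring.
- have /andP[_ lt_half] := lazy_ray n sp kB.
  exists (r ^+ n.+2 * F), (r ^+ n * F), (r ^+ n.+1 * F), (r ^+ n.+1 * F).
  rewrite gen_b_lt_half// gen_b_inv_lt_half// iterS gen_aK -iterS.
  have -> : (iter n.+1 (@gen_a R) p == Defs.half R) = false.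
    by apply: contraTF lt_half => /eqP ->; rewrite /= ltxx.
  split; first split.
  + exact: (vertex_lazy r d n.+2 sp kB).
  + exact: (vertex_lazy r d n sp kB).
  + exact: (vertex_lazy r d n.+1 sp kB).
  + exact: (vertex_lazy r d n.+1 sp kB).
  rewrite mulr0n add0r exprS {1}rE !exprS; ring.
- have [k' [F' [sp' kB FE]]] := spine_parentB sp.
  have ray := vertex_double r d 1 sp; rewrite expr1 in ray.
  have p34 := double_ray 0 sp; rewrite expr0 mul1r /= in p34 *.
  exists F', (d * F), (x * F), (d * F).
  have -> : (p == Defs.half R) = false.
    by apply: contraTF p34 => /eqP ->; rewrite /= -ltNge; lra.
  rewrite gen_b_inv_ge34//; split; first split => //.
  + exact: vertex_spineA sp'.
  + exact: vertex_spineA (spine_BA sp).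
  rewrite mulr0n add0r FE {1}yE; ring.
- have p78 := double_ray_ge78 n sp; have p34 := double_ray n.+1 sp.
  exists (d ^+ n * F), (d ^+ n.+2 * F), (d ^+ n * F), (d ^+ n.+2 * F).
  rewrite gen_b_inv_ge34// gen_b_ge78//.
  have -> : (iter n.+1 (@gen_a_inv R) p == Defs.half R) = false.
    by apply: contraTF p34 => /eqP ->; rewrite /= -ltNge; lra.
  rewrite iterS gen_a_invK -iterS.
  split; first split.
  + exact: (vertex_double r d n sp).
  + exact: (vertex_double r d n.+2 sp).
  + exact: (vertex_double r d n sp).
  + exact: (vertex_double r d n.+2 sp).
  rewrite mulr0n add0r exprS {1}dE !exprS; ring.
Qed.

Lemma orbit_half_self : orbit_half (Defs.half R).
Proof. by exists id => //; exact: thompsonF_id. Qed.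

(** By [vertex_step], the coefficients of the series [F * G] obey the recursion that defines
    [nstep_prob], with the same initial values. *)
Lemma nstep_prob_vertex r d x y G p F n :
  r = qX R * (1 + r + r + r ^+ 2) -> d = qX R * (1 + 1 + d ^+ 2 + d ^+ 2) ->
  x = qX R * (1 + (r + x + y) * x) -> y = qX R * (1 + (x + d + d) * y) ->
  G = 1 + qX R * ((r + y + 1 + 1) * G) ->
  vertex r d x y p F -> orbit_half p ->
  nstep_prob n p (Defs.half R) = (F * G) n.
Proof.
move=> rE dE xE yE GE; elim: n p F => [|n IH] p F vp Op;
  have [F1 [F2 [F3 [F4 [[v1 v2 v3 v4] ->]]]]] := vertex_step rE dE xE yE GE vp.
  by rewrite /= fpsD qX0 addr0; case: eqP.
rewrite /= step_sum//.
rewrite (IH _ _ v1) ?(IH _ _ v2) ?(IH _ _ v3) ?(IH _ _ v4);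
  try by apply: orbit_gens; rewrite ?inE ?eqxx ?orbT.
have -> : (F1 + F2 + F3 + F4) * G = F1 * G + F2 * G + F3 * G + F4 * G by ring.
by rewrite [RHS]fpsD qXS !fpsD; case: eqP => _; rewrite add0r.
Qed.

Lemma return_prob_coef r d x y G n :
  r = qX R * (1 + r + r + r ^+ 2) -> d = qX R * (1 + 1 + d ^+ 2 + d ^+ 2) ->
  x = qX R * (1 + (r + x + y) * x) -> y = qX R * (1 + (x + d + d) * y) ->
  G = 1 + qX R * ((r + y + 1 + 1) * G) ->
  return_prob R n = G n.
Proof.
move=> rE dE xE yE GE; rewrite -[G]mul1r.
apply: (nstep_prob_vertex n rE dE xE yE GE); last exact: orbit_half_self.
by apply: (vertex_spineA r d _ (spine_root x y)).
Qed.

End Walk.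

(** * The generating functions *)

Section Main.
Variable R : realType.
Implicit Types (a b : fps R) (n k : nat).
Notation w := (@w R).
Notation X := (qX R).

(** Mass 1 is preserved because each right-hand side has four terms of mass at most 1, weighted by
    1/4. *)
Lemma rays_exist : exists r d, [/\ mass_le 1 r, mass_le 1 d,
  r = X * (1 + r + r + r ^+ 2) & d = X * (1 + 1 + d ^+ 2 + d ^+ 2)].
Proof.
apply: (@fps_fixpoint2 _ 1 1 (fun r _ => X * (1 + r + r + r ^+ 2))
  (fun _ d => X * (1 + 1 + d ^+ 2 + d ^+ 2))) => //.
- move=> n a b a' b' aa bb; split; apply: agree_qX;
    do ![apply: agreeD|apply: agreeM|exact: agree_refl|assumption].
- move=> a b a1 b1; have a2 := massM a1 a1; have b2 := massM b1 b1.
  split.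
    apply: mass_leW (mass_qX (massD (massD (massD (mass1 R) a1) a1) a2)); lra.
  by apply: mass_leW (mass_qX (massD (massD (massD (mass1 R) (mass1 R)) b2) b2)); lra.
Qed.

(** The box is invariant: (1 + (1 + 3/5 + 5/7) (3/5)) / 4 < 3/5, and (1 + (3/5 + 2) (5/7)) / 4 = 5/7
    exactly. *)
Lemma hitting_exist r d : mass_le 1 r -> mass_le 1 d ->
  exists x y, [/\ mass_le (3 / 5) x, mass_le (5 / 7) y,
    x = X * (1 + (r + x + y) * x) & y = X * (1 + (x + d + d) * y)].
Proof.
move=> r1 d1; apply: (@fps_fixpoint2 _ (3 / 5) (5 / 7)
  (fun x y => X * (1 + (r + x + y) * x)) (fun x y => X * (1 + (x + d + d) * y))).
- lra.
- lra.
- move=> n a b a' b' aa bb; split; apply: agree_qX;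
    do ![apply: agreeD|apply: agreeM|exact: agree_refl|assumption].
- move=> x y x1 y1; split.
    apply: mass_leW (mass_qX (massD (mass1 R) (massM (massD (massD r1 x1) y1) x1))).
    by lra.
  apply: mass_leW (mass_qX (massD (mass1 R) (massM (massD (massD x1 d1) d1) y1))).
  by lra.
Qed.

Lemma rough_inverse (q : R) a : q < 4 -> mass_le q a -> rough a ->
  exists b, [/\ rough b, mass_le (1 - q / 4)^-1 b & b = 1 + X * (a * b)].
Proof.
move=> q4 aq ra; have [b bq bE] := fps_geom q4 aq.
by exists b; split=> //; exact: (rough_geom q4 aq bq ra bE).
Qed.

(** The hypothesis on [b] says that it is the inverse of [1 - X * a]. *)
Lemma linear_solve a b c u : b = 1 + X * (a * b) -> u = c + X * (a * u) ->
  u = b * c.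
Proof.
move=> bE uE; have -> : c = u - X * (a * u) by rewrite {1}uE addrK.
have -> : b * (u - X * (a * u)) = (b - X * (a * b)) * u by ring.
by rewrite {1}bE addrK mul1r.
Qed.

(* [1 - 2 X (1 + r)] is the square root of [1 - 4 X], that is of 1 - z, so its
   coefficients satisfy a first-order recurrence. *)
Lemma lazy_ray_asymptotic r : r = X * (1 + r + r + r ^+ 2) ->
  exists al C, forall n, `|r n - al * w n ^+ 3| <= C * w n ^+ 4.
Proof.
move=> rE; pose S := 1 - 2 * (X * (1 + r)).
have rE' : X * (1 + r) ^+ 2 = r by rewrite {2}rE; ring.
have S2 : S * S = 1 - 4 * X.
  transitivity (1 - 4 * (X * (1 + r)) + 4 * (X * (X * (1 + r) ^+ 2))).
    by rewrite /S; ring.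
  by rewrite rE'; ring.
have u2 : theta S * S + S * theta S = - (4 * X).
  rewrite -thetaM S2 thetaD theta1 add0r thetaN.
  rewrite (_ : 4 * X = X + X + X + X); last by ring.
  by rewrite !thetaD theta_qX.
(* Multiplying the derivative of S^2 = 1 - 4 X by S gives 2 (1 - 4 X) theta S = - 4 X S. *)
have uE : 2 * theta S = X * (8 * theta S - 4 * S).
  have E : S * S * (2 * theta S) = - (4 * X) * S by rewrite -u2; ring.
  transitivity (S * S * (2 * theta S) + 4 * X * (2 * theta S)).
    by rewrite S2; ring.
  by rewrite E; ring.
have [n|L [C HL]] := @half_power_asymptotic R S.
  have := congr1 (@^~ n.+1) uE; rewrite qXS fpsD fpsN !fps_natM /theta.
  by rewrite -[n.+1%:R]natr1; lra.
have rS n : r n = - 2 * S n.+1 - (1 : fps R) n.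
  by rewrite /S fpsD fpsN (@fps1 R n.+1)/= fps_natM qXS fpsD; lra.
exists (- 2 * L), (2 * C + 1) => n.
have -> : r n - - 2 * L * w n ^+ 3 = - 2 * (S n.+1 - L * w n ^+ 3) - (1 : fps R) n.
  by rewrite rS; ring.
rewrite [leRHS]mulrDl mul1r; apply: le_trans (ler_normB _ _) _; apply: lerD.
  by rewrite normrM normrN normr_nat -mulrA ler_wpM2l.
rewrite fps1; case: n => [|n]; first by rewrite w0 expr1n normr1.
by rewrite normr0 exprn_ge0 ?w_ge0.
Qed.

(** The series [T] is the square root of 1 - 16 X^2, that is of 1 - z^2: its odd coefficients vanish
    and the even ones satisfy the recurrence of (1 - X)^(1/2). *)
Lemma double_ray_asymptotic d : d = X * (1 + 1 + d ^+ 2 + d ^+ 2) ->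
  exists al be C, forall n,
    `|d n - (al + be * (-1) ^+ n) * w n ^+ 3| <= C * w n ^+ 4.
Proof.
move=> dE; pose T := 1 - 4 * (X * d).
have dE' : 2 * (X * (1 + d ^+ 2)) = d by rewrite {2}dE; ring.
have T2 : T * T = 1 - 16 * (X * X).
  transitivity (1 - 8 * (X * d) + 16 * (X * X) * d ^+ 2).
    by rewrite /T; ring.
  by rewrite -{1}dE'; ring.
have u2 : theta T * T + T * theta T = - (32 * (X * X)).
  rewrite -thetaM T2 thetaD theta1 add0r thetaN.
  have -> : 16 * (X * X) = 4 * X * (X + X + X + X) by ring.
  rewrite (_ : 4 * X = X + X + X + X); last by ring.
  by rewrite thetaM !thetaD theta_qX; ring.
have uE : 2 * theta T = X * (X * (32 * theta T - 32 * T)).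
  have E : T * T * (2 * theta T) = - (32 * (X * X)) * T by rewrite -u2; ring.
  transitivity (T * T * (2 * theta T) + 16 * (X * X) * (2 * theta T)).
    by rewrite T2; ring.
  by rewrite E; ring.
have Trec n : n.+2%:R * T n.+2 = (n%:R - 1) * T n.
  have := congr1 (@^~ n.+2) uE; rewrite !qXS fpsD fpsN !fps_natM /theta.
  by lra.
have dT n : d n = - T n.+1.
  by rewrite /T fpsD fpsN fps1/= fps_natM qXS; lra.
have Todd n : T (2 * n).+1 = 0.
  elim: n => [|n IH].
    by apply/eqP; rewrite -oppr_eq0 -dT dE qX0.
  rewrite (_ : (2 * n.+1).+1 = (2 * n).+3); last by lia.
  by apply: (@mulfI _ (2 * n).+3%:R); rewrite ?pnatr_eq0// Trec IH !mulr0.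
have [n|L [C HL]] := @half_power_asymptotic R (fun n => T (2 * n)%N).
  have := Trec (2 * n)%N; rewrite (_ : (2 * n.+1)%N = (2 * n).+2); last by lia.
  rewrite (_ : (2 * n).+2%:R = 2 * n.+1%:R :> R); last first.
    by rewrite -natrM; congr (_%:R); lia.
  by rewrite natrM; lra.
(* The factor comes from passing from the index n to 2 n + 1 in [w]. The two constants below cancel
   at even indices, where [d] vanishes. *)
pose s : R := Num.sqrt 2; have s0 : 0 <= s by exact: sqrtr_ge0.
have ws n : w n = s * w (2 * n).+1.
  rewrite /w /s (_ : (2 * n).+2%:R = 2 * n.+1%:R :> R); last first.
    by rewrite -natrM; congr (_%:R); lia.
  rewrite sqrtrM// invfM mulrA divff ?mul1r// gt_eqF// sqrtr_gt0//.
exists (- (L * s ^+ 3) / 2), (L * s ^+ 3 / 2), (C * s ^+ 4) => m.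
have C0 := rough_cst_ge0 HL.
have sgn n : (-1) ^+ (2 * n) = 1 :> R by rewrite exprM sqrrN !expr1n.
rewrite -[m]odd_double_half -mul2n; case: (odd m); rewrite ?add1n ?add0n; last first.
  rewrite dT Todd sgn mulr1 mulNr addNr mul0r oppr0 addr0 normr0.
  by rewrite !mulr_ge0 ?exprn_ge0 ?w_ge0.
move: (m./2) => n; rewrite (exprS (-1)) sgn mulr1 mulrN1.
have := HL n; rewrite ws -normrN dT (_ : (2 * n.+1)%N = (2 * n).+2); last by lia.
rewrite exprMn [in leRHS]exprMn [in leRHS]mulrA.
rewrite (_ : - T _ - _ = - (T (2 * n).+2 - L * (s ^+ 3 * w (2 * n).+1 ^+ 3))) //.
by field.
Qed.

Lemma return_series : exists G, [/\ rough G, tame (theta G) &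
  forall n, return_prob R n = G n].
Proof.
have [r [d [r1 d1 rE dE]]] := rays_exist.
have [x [y [x1 y1 xE yE]]] := hitting_exist r1 d1.
have [al [C HC]] := lazy_ray_asymptotic rE.
have {}HC n : `|r n - (al + 0 * (-1) ^+ n) * w n ^+ 3| <= C * w n ^+ 4.
  by rewrite mul0r addr0.
have rr := rough_of_asymptotic HC; have tr := tame_theta HC.
have [al' [be' [C' HC']]] := double_ray_asymptotic dE.
have rd := rough_of_asymptotic HC'; have td := tame_theta HC'.
have [rx ry] := rough_hitting r1 d1 x1 y1 rr rd xE yE.
have r1' := rough1 R; have rX := rough_qX R.
have m1 := mass1 R.
(* [K1] and [K2] invert the diagonal entries 1 - X (r + 2 x + y) and 1 - X (x + 2 d) of the
   linearized system for [x] and [y]. *)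
have [|K1 [rK1 mK1 K1E]] := rough_inverse _ (massD (massD (massD r1 x1) x1) y1)
  (roughD (roughD (roughD rr rx) rx) ry); first by lra.
have [|K2 [rK2 mK2 K2E]] := rough_inverse _ (massD (massD x1 d1) d1)
  (roughD (roughD rx rd) rd); first by lra.
(* [K3] inverts 1 - X^2 x y K1 K2, which remains once [theta x] is eliminated. The masses of [K1]
   and [K2] are at most 70/19 and 20/7. *)
have [|K3 [rK3 mK3 K3E]] := rough_inverse _
  (mass_qX (massM (massM x1 y1) (massM mK1 mK2)))
  (roughM rX (roughM (roughM rx ry) (roughM rK1 rK2))).
  rewrite (_ : (1 - _ / 4)^-1 = 70 / 19); last by field.
  rewrite (_ : (1 - _ / 4)^-1 = 20 / 7); last by field.
  by lra.
have [|G [rG mG GE]] := rough_inverse _ (massD (massD (massD r1 y1) m1) m1)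
  (roughD (roughD (roughD rr ry) r1') r1'); first by lra.
(* Differentiating x = X (...) gives x + X theta (...), since [theta] fixes [X]. *)
have dx : theta x = K1 * (x + X * (x * (theta r + theta y))).
  apply: (linear_solve K1E).
  rewrite {1}xE thetaM theta_qX -xE thetaD theta1 thetaM !thetaD; ring.
have dy1 : theta y = K2 * (y + X * (y * (theta x + theta d + theta d))).
  apply: (linear_solve K2E).
  rewrite {1}yE thetaM theta_qX -yE thetaD theta1 thetaM !thetaD; ring.
have dy : theta y = K3 * (K2 * (y + X * (y * (theta d + theta d))) +
    K2 * (X * (y * (K1 * (x + X * (x * theta r)))))).
  by apply: (linear_solve K3E); rewrite {1}dy1 dx; ring.
have ty : tame (theta y).
  rewrite dy; apply: rough_tameM => //; apply: tameD; apply: rough_tameM => //.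
    apply: tameD; first exact: rough_tame.
    by do 2 apply: rough_tameM => //; exact: tameD.
  do 3 apply: rough_tameM => //; apply: tameD; first exact: rough_tame.
  by do 2 apply: rough_tameM => //.
exists G; split=> // [|n]; last exact: return_prob_coef rE dE xE yE GE.
have -> : theta G = G * (X * ((r + y + 1 + 1) * G) + X * (G * (theta r + theta y))).
  apply: (linear_solve GE).
  rewrite {1}GE thetaD theta1 thetaM theta_qX thetaM !thetaD theta1; ring.
apply: rough_tameM => //; apply: tameD.
  by apply: rough_tame; do ![apply: roughM|apply: roughD].
by do 2 apply: rough_tameM => //; exact: tameD.
Qed.

End Main.

(** * From the weights [w] to powers of n, along even and odd indices *)

Section Conclusion.
Variable R : realType.
Implicit Types (n m : nat).
Notation w := (@w R).

Lemma powR_N32 (v : R) : 0 < v -> v `^ (- (3 / 2)) = (v * Num.sqrt v)^-1.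
Proof.
move=> v0; rewrite powRN; congr (_^-1).
have -> : 3 / 2 = 1 + 2^-1 :> R by lra.
by rewrite powRD ?powRr1 ?powR12_sqrt ?ltW ?gt_eqF ?implybT.
Qed.

Lemma powR_N2 (v : R) : 0 <= v -> v `^ (- 2) = (v ^+ 2)^-1.
Proof. by move=> v0; rewrite powRN (powR_mulrn 2). Qed.

(** To be applied at 2 n, with [m] equal to 2 n or 2 n + 1, so that both parities are compared with
    the same power. *)
Lemma w_div_approx (n m : nat) : (0 < n)%N -> (n <= m <= n.+1)%N ->
  `|w m / m%:R - (n%:R * Num.sqrt n%:R)^-1| <= 6 / n%:R ^+ 2.
Proof.
move=> n0 /andP[nm mn].
have x1 : 1 <= n%:R :> R by rewrite ler1n.
have xm : n%:R <= m%:R :> R by rewrite ler_nat.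
have mx : m%:R <= n%:R + 1 :> R by rewrite natr1 ler_nat.
rewrite /w; have v2 := sqr_sqrtr (ler0n R m.+1); have u2 := sqr_sqrtr (ler0n R n).
have v0 := sqrtr_ge0 (m.+1%:R : R); have u0 := sqrtr_ge0 (n%:R : R).
move: (Num.sqrt m.+1%:R) (Num.sqrt n%:R) v2 u2 v0 u0 => v u v2 u2 v0 u0.
rewrite -natr1 in v2; move: (n%:R) (m%:R) x1 xm mx v2 u2 => x y x1 xm mx v2 u2.
have u1 : 1 <= u by rewrite -(ler_pXn2r (n := 2)) ?nnegrE// expr1n u2.
have uv : u <= v by rewrite -(ler_pXn2r (n := 2)) ?nnegrE// v2 u2; lra.
have v2u : v <= 2 * u.
  by rewrite -(ler_pXn2r (n := 2)) ?nnegrE ?mulr_ge0// exprMn v2 u2; lra.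
have y0 : 0 < y by lra.
have u_gt0 : 0 < u by lra.
have v_gt0 : 0 < v by lra.
have x_gt0 : 0 < x by lra.
have -> : v^-1 / y - (x * u)^-1 = - ((y * v - x * u) / (y * v * (x * u))).
  by field; rewrite !gt_eqF.
have xuyv : x * u <= y * v by rewrite ler_pM// ltW.
rewrite normrN ger0_norm; last first.
  by rewrite divr_ge0 ?subr_ge0// !mulr_ge0// ltW.
(* [y v - x u <= v^3 - u^3 <= 3 v^2 (v - u)] and [(v - u) (v + u) <= 2] *)
have vu2 : (v - u) * (v + u) <= 2 by nra.
have H : y * v - x * u <= 6 * v.
  have h1 : y * v - x * u <= (v - u) * (v ^+ 2 + v * u + u ^+ 2) by nra.
  apply: le_trans h1 _.
  have h2 : v ^+ 2 + v * u + u ^+ 2 <= 3 * v * (v + u) by nra.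
  apply: (@le_trans _ _ ((v - u) * (3 * v * (v + u)))).
    by rewrite ler_wpM2l// subr_ge0.
  nra.
apply: (@le_trans _ _ (6 * v / (y * v * (x * u)))).
  by rewrite ler_wpM2r// invr_ge0 !mulr_ge0// ltW.
rewrite (_ : 6 * v / _ = 6 / (y * (x * u))); last by field; rewrite !gt_eqF.
rewrite ler_wpM2l// lef_pV2 ?posrE ?mulr_gt0 ?exprn_gt0//.
by rewrite expr2; apply: ler_pM; rewrite ?(ltW x_gt0)// ler_peMr// ltW.
Qed.

Lemma theta_tame_approx (G : fps R) : tame (theta G) ->
  exists al be C, 0 <= C /\ forall n m, (0 < n)%N -> (n <= m <= n.+1)%N ->
    `|G m - (al + be * (-1) ^+ m) * (n%:R * Num.sqrt n%:R)^-1| <= C / n%:R ^+ 2.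
Proof.
move=> [al [be [C GC]]]; have C0 := rough_cst_ge0 GC.
exists al, be, (C + 6 * (`|al| + `|be|)); split.
  by rewrite addr_ge0 ?mulr_ge0 ?addr_ge0.
move=> n m n0 nm; have := w_div_approx n0 nm; have := GC m; rewrite /theta.
case/andP: nm => nm _.
have x0 : 0 < n%:R :> R by rewrite ltr0n.
have y0 : 0 < m%:R :> R by rewrite ltr0n (leq_trans n0).
have xy : n%:R <= m%:R :> R by rewrite ler_nat.
set c := al + _ => H1 H2.
have c_le : `|c| <= `|al| + `|be|.
  apply: le_trans (ler_normD _ _) _; rewrite lerD2l normrM.
  by rewrite normrX normrN1 expr1n mulr1.
rewrite (_ : G m - _ = (m%:R * G m - c * w m) / m%:R +
  c * (w m / m%:R - (n%:R * Num.sqrt n%:R)^-1)); last first.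
  by field; rewrite !gt_eqF// sqrtr_gt0.
rewrite [leRHS]mulrDl; apply: le_trans (ler_normD _ _) _; apply: lerD.
  rewrite normrM (ger0_norm (_ : 0 <= m%:R^-1)) ?invr_ge0//.
  apply: (@le_trans _ _ (C * w m ^+ 2 / m%:R)); first by rewrite ler_wpM2r.
  rewrite -mulrA ler_wpM2l// w_sqr -invfM lef_pV2 ?posrE ?mulr_gt0 ?exprn_gt0//.
  by rewrite expr2 ler_pM// ler_nat (leq_trans nm).
by rewrite normrM -mulrA mulrCA; apply: ler_pM.
Qed.

Lemma bigO_subsequence (p : nat -> R) (k : nat -> nat) (c C : R) :
  0 <= C ->
  (forall n, (0 < n)%N ->
    `|p (k n) - c * ((2 * n)%:R * Num.sqrt (2 * n)%:R)^-1| <= C / (2 * n)%:R ^+ 2) ->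
  (fun n => p (k n) - c * 2 `^ (- (3 / 2)) * n%:R `^ (- (3 / 2)))
    =O_\oo (fun n => n%:R `^ (- 2) : R).
Proof.
(* A positive constant is required, and [C] may be 0. *)
move=> C0 H; apply/eqO_exP; exists (C + 1); first by lra.
near=> n.
have n0 : (0 < n)%N by near: n; exact: nbhs_infty_gt.
have x0 : 0 < n%:R :> R by rewrite ltr0n.
have := H n n0; rewrite -powR_N32 ?ltr0n ?muln_gt0// natrM powRM// mulrA.
move=> {}H; apply: le_trans H _.
rewrite powR_N2 ?(ltW x0)// ger0_norm ?invr_ge0 ?sqr_ge0//.
rewrite exprMn invfM mulrA ler_wpM2r ?invr_ge0 ?sqr_ge0//.
by rewrite ler_pdivrMr ?exprn_gt0//; lra.
Unshelve. all: by end_near.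
Qed.

End Conclusion.

Theorem theorem3 (R : realType) :
  exists A B : R,
    ((fun n : nat => return_prob R (2 * n) - A * n%:R `^ (- (3 / 2)))
       =O_\oo (fun n : nat => n%:R `^ (- 2) : R)) /\
    ((fun n : nat => return_prob R (2 * n + 1) - B * n%:R `^ (- (3 / 2)))
       =O_\oo (fun n : nat => n%:R `^ (- 2) : R)).
Proof.
have [G [_ tG pG]] := return_series R.
have [al [be [C [C0 H]]]] := theta_tame_approx tG.
(* (-1)^m is 1 at m = 2 n and -1 at m = 2 n + 1; the power of 2 turns (2 n)^(-3/2) into n^(-3/2). *)
exists ((al + be) * 2 `^ (- (3 / 2))), ((al - be) * 2 `^ (- (3 / 2))).
have sgn n : (-1) ^+ (2 * n) = 1 :> R by rewrite exprM sqrrN !expr1n.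
split.
  apply: (@bigO_subsequence _ (return_prob R) (fun n => 2 * n)%N _ C) => // n n0.
  have := H (2 * n)%N (2 * n)%N; rewrite sgn mulr1 pG; apply; lia.
apply: (@bigO_subsequence _ (return_prob R) (fun n => 2 * n + 1)%N _ C) => // n n0.
have := H (2 * n)%N (2 * n + 1)%N; rewrite exprD sgn expr1 mul1r mulrN1 pG; apply; lia.
Qed.
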